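(* There is an absolute constant $C>0$ such that for all positive integers $n$ and $t$ with $t\ge 2$: there exists an edge-ordered graph on at most $2^{Cnt(\log_2 n)(\log_2 t)}$ vertices that is Ramsey $\mathcal{F}_{n,t}$ universal; and $r_{\text{edge}}(H_1,H_2)\le 2^{Cnt(\log_2 n)(\log_2 t)}$ for all $H_1\in\mathcal{F}_n$ and $H_2\in\mathcal{F}_{n,t}$.
   Context: An edge-ordered graph is a finite simple graph together with a total ordering of its edges. Two edge-ordered graphs are equivalent if there is a graph isomorphism between them preserving the ordering of the edges; a copy of $H$ in $G$ is a subgraph of $G$ (with inherited edge-ordering) equivalent to $H$. $\mathcal{F}_n$ is the family of all edge-ordered graphs on $n$ vertices and $\mathcal{F}_{n,t}$ the family of all edge-ordered graphs on $n$ vertices with chromatic number at most $t$. Given a family $\mathcal{F}$ of edge-ordered graphs, an edge-ordered graph $G$ is Ramsey $\mathcal{F}$ universal if for every two-coloring of the edges of $G$ there exists a monochromatic subgraph of $G$ containing a copy of every edge-ordered graph in $\mathcal{F}$. For edge-ordered graphs $H_1,H_2$, $r_{\text{edge}}(H_1,H_2)$ is the smallest $N$ such that there exists an edge-ordered graph $G$ on $N$ vertices such that every red-blue coloring of the edges of $G$ contains either a red copy of $H_1$ or a blue copy of $H_2$. *)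

(* Defs.v *)
From HB Require Import structures.
From mathcomp Require Import all_boot all_order all_algebra.
From mathcomp Require Import boolp reals exp.

Set Implicit Arguments.
Unset Strict Implicit.
Unset Printing Implicit Defensive.

Import Order.TTheory GRing.Theory Num.Theory.

(* The vertex set is a subset of an ambient finite type T, so that a graph and
   its subgraphs live over the same type. Edges are 2-element sets of vertices;
   only the restriction of [ele] to [edges] is meaningful. *)
Record eograph (T : finType) := EOGraph {
  verts : {set T};
  edges : {set {set T}};
  ele : rel {set T};
  edges_card2 : {in edges, forall e : {set T}, #|e| = 2};
  edges_verts : {in edges, forall e : {set T}, e \subset verts};
  ele_refl : {in edges, reflexive ele};
  ele_anti : {in edges &, antisymmetric ele};
  ele_trans : {in edges & &, transitive ele};
  ele_total : {in edges &, total ele}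
}.

Definition subgraph (T : finType) (G' G : eograph T) : Prop :=
  [/\ verts G' \subset verts G,
      edges G' \subset edges G
    & {in edges G' &, forall e f : {set T}, ele G' e f = ele G e f}].

Definition equivalent (T T' : finType) (H : eograph T) (G : eograph T') : Prop :=
  exists f : T -> T',
    [/\ {in verts H &, injective f},
        f @: verts H = verts G,
        {in verts H &, forall x y : T,
           ([set f x; f y] \in edges G) = ([set x; y] \in edges H)}
      & {in edges H &, forall d e : {set T}, ele G (f @: d) (f @: e) = ele H d e}].

Definition is_copy (S T : finType) (H : eograph S) (G' G : eograph T) : Prop :=
  subgraph G' G /\ equivalent H G'.

Definition contains_copy (S T : finType) (H : eograph S) (G : eograph T) : Prop :=
  exists G' : eograph T, is_copy H G' G.

Definition colorable (T : finType) (G : eograph T) (k : nat) : Prop :=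
  exists c : T -> nat,
    {in verts G, forall x : T, c x < k} /\
    (forall x y : T, [set x; y] \in edges G -> c x <> c y).

Lemma colorable_exists (T : finType) (G : eograph T) :
  exists k, `[< colorable G k >].
Proof.
exists #|T|; apply/asboolP; exists (fun x => enum_rank x : nat); split.
  by move=> x _; exact: ltn_ord.
move=> x y /edges_card2 + /ord_inj /enum_rank_inj xy.
by rewrite xy setUid cards1.
Qed.

Definition chromatic_number (T : finType) (G : eograph T) : nat :=
  ex_minn (colorable_exists G).

Definition eofamily := forall T : finType, eograph T -> Prop.

Definition Fam (n : nat) : eofamily := fun T G => #|verts G| = n.

Definition Famchi (n t : nat) : eofamily :=
  fun T G => #|verts G| = n /\ chromatic_number G <= t.

(* A two-coloring of the edges of G is given by c : {set T} -> bool, whose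
   values off the edges of G are irrelevant. *)
Definition colored (T : finType) (c : {set T} -> bool) (b : bool)
    (M : eograph T) : Prop :=
  {in edges M, forall e : {set T}, c e = b}.

Definition ramsey_universal (F : eofamily) (T : finType) (G : eograph T) : Prop :=
  forall c : {set T} -> bool,
    exists M : eograph T,
      [/\ subgraph M G,
          exists b, colored c b M
        & forall (S : finType) (H : eograph S), F S H -> contains_copy H M].

(* true is red, false is blue. *)
Definition edge_arrows (T T1 T2 : finType) (G : eograph T)
    (H1 : eograph T1) (H2 : eograph T2) : Prop :=
  forall c : {set T} -> bool,
    (exists2 G' : eograph T, is_copy H1 G' G & colored c true G') \/
    (exists2 G' : eograph T, is_copy H2 G' G & colored c false G').

Definition edge_ramsey_order (T1 T2 : finType)
    (H1 : eograph T1) (H2 : eograph T2) (N : nat) : Prop :=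
  exists (T : finType) (G : eograph T),
    #|verts G| = N /\ edge_arrows G H1 H2.

(* N = r_edge(H1, H2). As a relation rather than a function it carries no
   default value: asserting it of some N includes that r_edge is defined. *)
Definition is_r_edge (T1 T2 : finType)
    (H1 : eograph T1) (H2 : eograph T2) (N : nat) : Prop :=
  edge_ramsey_order H1 H2 N /\
  (forall M, edge_ramsey_order H1 H2 M -> N <= M).

Definition log2 (R : realType) (x : R) : R := (ln x / ln 2)%R.

Definition bound (R : realType) (C : R) (n t : nat) : R :=
  (2 `^ (C * n%:R * t%:R * log2 n%:R * log2 t%:R))%R.

(* Main.v *)
(* Let F be a field with q = 2 ^ m elements and label the pair x, y of points of
   F * F by x1 * y1 + x2 + y2, read as a number below q.  Order the edges of the
   complete graph on F * F by their labels.  For every set L of labels, all but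
   few vertices y have about |A| |L| / q neighbours with label in L in any fixed
   large set A.  Write labels in base M >= n ^ 2, so that the labels extending a given
   word of digits still leave one digit to encode the rank of an edge of an n-vertex
   graph H.

   Fix a colouring without a red copy of H1.  Greedy embedding of H1 in a set W,
   with the ranks encoded by the digit after a word w, must fail, which yields large
   A, B in W and a digit a such that few of the pairs in A * B are red with a label
   extending wa.  Recursing first in A and then in B with the longer word obtained
   from A gives 2 ^ k >= t large parts and one word of 2 ^ k - 1 digits whose labels
   are almost never red between the parts.  Finally H2 is embedded
   vertex by vertex, each colour class of a proper t-colouring in its own part and the
   ranks encoded by one more digit, while controlling the density of the forbidden
   red pairs. *)

Require Import Defs.
From HB Require Import structures.
From mathcomp Require Import all_boot all_order all_algebra.
From mathcomp Require Import boolp reals exp.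
From mathcomp Require Import finfield ring lra zify.

Set Implicit Arguments.
Unset Strict Implicit.
Unset Printing Implicit Defensive.

Import Order.TTheory GRing.Theory Num.Theory.

(** * Pseudorandomness of the labelling *)

Section Pseudorandom.

Local Open Scope ring_scope.

Variable R : realFieldType.

Definition deg (T : finType) (nb : rel T) (A : {set T}) (y : T) : R :=
  \sum_(x in A) (nb x y)%:R.

Definition ecount (T : finType) (r : rel T) (A B : {set T}) : R :=
  \sum_(x in A) \sum_(y in B) (r x y)%:R.

(** The Chebyshev form of a bound [beta * #|A|] on the sum of squared deviations of the degrees into
    [A] from [lam * #|A|]. The set [A] is arbitrary, so it may itself be a neighbourhood chosen
    earlier. *)
Definition pseudorandom (T : finType) (lam beta : R) (nb : rel T) : Prop :=
  forall (A : {set T}) (kap : R), 0 <= kap ->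
    #|[set y | kap <= `|deg nb A y - lam * #|A|%:R|]|%:R * kap ^+ 2
      <= beta * #|A|%:R.

Lemma chebyshev_count (T : finType) (g : T -> R) (kap : R) : 0 <= kap ->
  #|[set y | kap <= `|g y|]|%:R * kap ^+ 2 <= \sum_y g y ^+ 2.
Proof.
move=> kap0; rewrite (bigID (fun y => kap <= `|g y|)) /=.
rewrite -[leLHS]addr0 lerD ?sumr_ge0 // => [|y _]; last exact: sqr_ge0.
rewrite -sum1dep_card natr_sum mulr_suml.
apply: ler_sum => y ley; rewrite mul1r -(real_normK (num_real (g y))).
by rewrite lerXn2r ?nnegrE.
Qed.

End Pseudorandom.

Section FieldGraph.

Local Open Scope ring_scope.

Variables (R : realFieldType) (F : finFieldType).

Definition fadj (x y : F * F) : F := x.1 * y.1 + x.2 + y.2.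

Lemma fadjC x y : fadj x y = fadj y x.
Proof. by rewrite /fadj mulrC addrAC. Qed.

(** Both labels are affine in [y]. Their difference determines [y.1] because the slopes [x.1] and
    [x'.1] differ, and then either label determines [y.2]. *)
Lemma fadj_pair_inj x x' : x.1 != x'.1 ->
  injective (fun y => (fadj x y, fadj x' y)).
Proof.
move=> neq [c d] [c' d'] [] /=; rewrite /fadj /= => e1 e2.
have ec : (x.1 - x'.1) * (c - c') = 0.
  rewrite (_ : _ * _ = (x.1 * c + x.2 + d) - (x.1 * c' + x.2 + d')
     - ((x'.1 * c + x'.2 + d) - (x'.1 * c' + x'.2 + d'))); last by ring.
  by rewrite e1 e2; ring.
move/eqP: ec; rewrite mulf_eq0 subr_eq0 (negbTE neq) /= subr_eq0 => /eqP ec.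
by move: e1; rewrite ec => /addrI ->.
Qed.

(* Second moment: for x, x' with distinct first coordinates the labels of (x, y)
   and (x', y) are independent as y varies, so such pairs contribute 0 to the
   variance. *)
Lemma fadj_pseudorandom (S : {set F}) :
  pseudorandom (#|S|%:R / #|F|%:R) (#|F|%:R ^+ 3 : R)
    (fun x y => fadj x y \in S).
Proof.
move=> A kap kap0; set lam : R := _ / _; set q : R := #|F|%:R.
have q0 : 0 < q by rewrite ltr0n; apply/card_gt0P; exists 0.
pose g (a : F) : R := (a \in S)%:R - lam.
have lam01 : 0 <= lam <= 1.
  rewrite divr_ge0 ?ler0n //= ler_pdivrMr // mul1r ler_nat.
  exact: max_card.
have g1 a : `|g a| <= 1.
  rewrite ler_norml /g; case: (a \in S) => /=; lra.
have sumg : \sum_a g a = 0.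
  rewrite sumrB sumr_const -[X in _ - X]mulr_natr divfK ?gt_eqF //.
  rewrite -[in X in _ - X]sum1_card natr_sum [X in _ - X]big_mkcond /=.
  by apply/eqP; rewrite subr_eq0; apply/eqP/eq_bigr => a _; case: (a \in S).
apply: le_trans (chebyshev_count _ kap0) _.
have degE y : deg R (fun x y => fadj x y \in S) A y - lam * #|A|%:R
    = \sum_(x in A) g (fadj x y).
  by rewrite /deg sumrB sumr_const mulr_natr.
under eq_bigr do rewrite degE expr2 big_distrlr /=.
rewrite exchange_big /= mulr_natr -sumr_const; apply: ler_sum => x xA.
rewrite exchange_big /=.
have corr x' : \sum_y g (fadj x y) * g (fadj x' y)
    <= if x.1 == x'.1 then q ^+ 2 else 0.
  case: ifPn => [_|neq].
    apply: (@le_trans _ _ (\sum_(y : F * F) 1)).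
      apply: ler_sum => y _; apply: le_trans (ler_norm _) _.
      by rewrite normrM mulr_ile1.
    by rewrite sumr_const card_prod natrM expr2.
  rewrite -(reindex_inj (fadj_pair_inj neq) (P := xpredT)
    (F := fun z : F * F => g z.1 * g z.2)) /=.
  rewrite -(pair_bigA _ (fun a b => g a * g b)) /=.
  by rewrite -big_distrlr /= sumg mul0r.
(* Each [x] in [A] correlates only with the [q] points that share its first coordinate, and each
   such pair contributes at most [q ^+ 2]; this gives [q ^+ 3] per element of [A]. *)
apply: (@le_trans _ _ (\sum_(x' : F * F | x'.1 == x.1) q ^+ 2)).
  rewrite [leRHS]big_mkcond /= [leLHS]big_mkcond; apply: ler_sum => x' _.
  case: (x' \in A); first by rewrite eq_sym corr.
  by case: ifP; rewrite ?sqr_ge0.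
rewrite sumr_const -mulr_natr (_ : #|_| = #|F|) -?exprSr //.
rewrite (_ : #|_| = #|setX [set x.1] [set: F]|).
  by rewrite cardsX cards1 cardsT mul1n.
by apply: eq_card => z; rewrite !inE andbT unfold_in.
Qed.

End FieldGraph.

(** * Embedding into a pseudorandom labelling *)

Section Embedding.

Local Open Scope ring_scope.

Variable R : realFieldType.

Lemma natr_cond_card (T : finType) (A : {set T}) (P : pred T) :
  \sum_(x in A) (P x)%:R = #|[set x in A | P x]|%:R :> R.
Proof.
rewrite -sum1dep_card natr_sum [RHS]big_mkcondr.
by apply: eq_bigr => x _; case: (P x).
Qed.

Lemma sum_le_card (T : finType) (A : {set T}) (P : pred T) :
  \sum_(x in A) (P x)%:R <= #|A|%:R :> R.
Proof.
by rewrite natr_cond_card ler_nat subset_leq_card // setIdE subsetIl.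
Qed.

Lemma ecount_ge0 (T : finType) (r : rel T) (A B : {set T}) : 0 <= ecount R r A B.
Proof. by apply: sumr_ge0 => x _; apply: sumr_ge0 => y _; rewrite ler0n. Qed.

Lemma ecount_sub (T : finType) (r r' : rel T) (A A' B B' : {set T}) :
  A \subset A' -> B \subset B' ->
  {in A & B, forall x y, r x y -> r' x y} ->
  ecount R r A B <= ecount R r' A' B'.
Proof.
move=> sA sB sr; rewrite /ecount [leRHS](big_setID A) /= (setIidPr sA).
rewrite -[leLHS]addr0 lerD //; last first.
  by apply: sumr_ge0 => x _; apply: sumr_ge0 => y _; rewrite ler0n.
apply: ler_sum => x xA; rewrite [leRHS](big_setID B) /= (setIidPr sB).
rewrite -[leLHS]addr0 lerD //; last by apply: sumr_ge0 => y _; rewrite ler0n.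
apply: ler_sum => y yB; rewrite ler_nat; case rxy: (r x y) => //.
by rewrite sr.
Qed.

Lemma ecount_nbhd (T : finType) (r : rel T) (A B : {set T}) (P Q : pred T) :
  ecount R r [set x in A | P x] [set y in B | Q y]
  = \sum_(x in A) \sum_(y in B) (r x y)%:R * ((P x)%:R * (Q y)%:R).
Proof.
rewrite /ecount (eq_bigl (fun x => (x \in A) && P x)); last by move=> x; rewrite inE.
rewrite big_mkcondr; apply: eq_bigr => x _.
rewrite (eq_bigl (fun x => (x \in B) && Q x)); last by move=> y; rewrite inE.
rewrite big_mkcondr; case: (P x) => /=; last first.
  by rewrite big1 // => y _; rewrite mul0r mulr0.
by apply: eq_bigr => y _; case: (Q y); rewrite mul1r ?mulr1 ?mulr0.
Qed.

(** Exchanging the sums weights each pair [(z, b)] of [r] by its codegree in [U]. Unless [b] has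
    atypical degree into [U], or [z] into the neighbourhood of [b], this codegree is at most
    [(1 + 2 * eps) * lam ^+ 2 * #|U|]. Exceptional pairs are counted with the trivial codegree bound
    [#|U|] and make up the error term. *)
Lemma codegree_sum (T : finType) (lam beta eps : R) (nb1 nb2 r : rel T)
    (U A B : {set T}) :
  0 < lam -> 0 < eps -> 0 <= beta -> (0 < #|U|)%N ->
  pseudorandom lam beta nb1 -> pseudorandom lam beta nb2 -> lam <= 1 ->
  \sum_(x in U) ecount R r [set z in A | nb1 x z] [set b in B | nb2 x b]
  <= (1 + 2 * eps) * lam ^+ 2 * #|U|%:R * ecount R r A B
     + beta / (eps ^+ 2 * lam ^+ 4) * (#|A|%:R + #|B|%:R).
Proof.
move=> lam0 eps0 beta0 U0 pr1 pr2 lam1.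
set u : R := #|U|%:R; have u0 : 0 < u by rewrite ltr0n.
pose N b := [set x in U | nb2 x b].
have NU b : #|N b|%:R = deg R nb2 U b by rewrite /deg natr_cond_card.
have N_le b : #|N b|%:R <= u by rewrite NU sum_le_card.
pose codeg z b := deg R nb1 (N b) z.
have codegE z b : \sum_(x in U) (nb1 x z)%:R * (nb2 x b)%:R = codeg z b.
  rewrite /codeg /deg [RHS](eq_bigl (fun x => (x \in U) && nb2 x b)).
    rewrite big_mkcondr; apply: eq_bigr => x _.
    by case: (nb2 x b); rewrite ?mulr1 ?mulr0.
  by move=> x; rewrite inE.
have -> : \sum_(x in U) ecount R r [set z in A | nb1 x z] [set b in B | nb2 x b]
    = \sum_(z in A) \sum_(b in B) (r z b)%:R * codeg z b.
  under eq_bigr do rewrite ecount_nbhd.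
  rewrite exchange_big /=; apply: eq_bigr => z _.
  rewrite exchange_big /=; apply: eq_bigr => b _.
  by rewrite -mulr_sumr codegE.
pose E2 := [set b | eps * lam * u <= `|deg R nb2 U b - lam * u|].
pose E1 b := [set z | eps * lam ^+ 2 * u <=
  `|deg R nb1 (N b) z - lam * #|N b|%:R|].
have cE2 : u * #|E2|%:R <= beta / (eps ^+ 2 * lam ^+ 4).
  have k0 : 0 <= eps * lam * u by rewrite !mulr_ge0 ?ltW.
  have := pr2 U _ k0; rewrite -/u -/E2 => h.
  rewrite ler_pdivlMr ?mulr_gt0 ?exprn_gt0 //.
  have h2 : #|E2|%:R * u * (eps ^+ 2 * lam ^+ 2) <= beta.
    rewrite -(ler_pM2r u0); apply: le_trans h; rewrite le_eqVlt; apply/orP; left.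
    by apply/eqP; ring.
  (* The deviation for [E2] would allow [lam ^+ 2]; weakening it gives both kinds of exceptional
     sets the same bound. *)
  have l4 : lam ^+ 4 <= lam ^+ 2.
    rewrite -[4%N]/(2 + 2)%N exprD; apply: ler_piMl.
      exact: exprn_ge0 (ltW lam0).
    exact: exprn_ile1 (ltW lam0) lam1.
  apply: le_trans h2; rewrite [u * _]mulrC; apply: ler_wpM2l.
    exact: mulr_ge0 (ler0n _ _) (ltW u0).
  exact: ler_wpM2l (exprn_ge0 _ (ltW eps0)) _ _ l4.
have cE1 b : u * #|E1 b|%:R <= beta / (eps ^+ 2 * lam ^+ 4).
  have k0 : 0 <= eps * lam ^+ 2 * u by rewrite !mulr_ge0 ?exprn_ge0 ?ltW.
  have := pr1 (N b) _ k0; rewrite -/(E1 b) => h.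
  rewrite ler_pdivlMr ?mulr_gt0 ?exprn_gt0 // -(ler_pM2r u0).
  apply: le_trans (ler_wpM2l beta0 (N_le b)); apply: le_trans h.
  by rewrite le_eqVlt; apply/orP; left; apply/eqP; ring.
have point z b : codeg z b <= (1 + 2 * eps) * lam ^+ 2 * u
    + u * (b \in E2)%:R + u * (z \in E1 b)%:R.
  have le_u : codeg z b <= u by apply: le_trans (N_le b); exact: sum_le_card.
  have pos : 0 <= (1 + 2 * eps) * lam ^+ 2 * u.
    by rewrite !mulr_ge0 ?exprn_ge0 ?ltW // addr_gt0 ?mulr_gt0.
  case bE: (b \in E2); case zE: (z \in E1 b); rewrite ?mulr1 ?mulr0; try lra.
  move/negbT: bE; rewrite inE -ltNge -NU ltr_distl => /andP[_ hb].
  move/negbT: zE; rewrite inE -ltNge ltr_distl -/(codeg z b) => /andP[_ hz].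
  rewrite !addr0; apply: le_trans (ltW hz) _.
  have := ltW hb; rewrite -(ler_pM2l lam0) => hb'.
  apply: (le_trans (lerD hb' (lexx _))).
  by rewrite le_eqVlt; apply/orP; left; apply/eqP; ring.
apply: (@le_trans _ _ (\sum_(z in A) \sum_(b in B)
  ((1 + 2 * eps) * lam ^+ 2 * u * (r z b)%:R
     + (u * (b \in E2)%:R + u * (z \in E1 b)%:R)))).
  apply: ler_sum => z _; apply: ler_sum => b _.
  case: (r z b); last first.
    by rewrite mul0r mulr0 add0r addr_ge0 ?mulr_ge0 ?ler0n ?ltW.
  by rewrite mul1r mulr1 addrA.
under eq_bigr do rewrite big_split /= -mulr_sumr.
rewrite big_split /= -mulr_sumr lerD //.
under eq_bigr do rewrite big_split /=.
rewrite big_split /= mulrDr lerD //.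
  apply: (@le_trans _ _ (\sum_(z in A) (beta / (eps ^+ 2 * lam ^+ 4)))).
    apply: ler_sum => z _; rewrite -mulr_sumr; apply: le_trans cE2.
    apply: (ler_wpM2l (ltW u0)); rewrite natr_cond_card ler_nat subset_leq_card //.
    by apply/subsetP => y; rewrite inE => /andP[].
  by rewrite sumr_const mulr_natr.
rewrite exchange_big /=.
apply: (@le_trans _ _ (\sum_(b in B) (beta / (eps ^+ 2 * lam ^+ 4)))).
  apply: ler_sum => b _; rewrite -mulr_sumr; apply: le_trans (cE1 b).
  apply: (ler_wpM2l (ltW u0)); rewrite natr_cond_card ler_nat subset_leq_card //.
  by apply/subsetP => y; rewrite inE => /andP[].
by rewrite sumr_const mulr_natr.
Qed.

(** At least [(1 - eps) * #|U|] elements survive the removal of [E]; if [Q] exceeded [c] on all of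
    them, its sum would be too large. *)
Lemma exists_le_average (T : finType) (U E : {set T}) (Q : T -> R) (c eps : R) :
  {in U, forall x, 0 <= Q x} -> 0 <= c -> eps < 1 -> (0 < #|U|)%N ->
  #|E|%:R <= eps * #|U|%:R -> \sum_(x in U) Q x <= (1 - eps) * #|U|%:R * c ->
  exists2 x, x \in U :\: E & Q x <= c.
Proof.
move=> Q0 c0 eps1 U0 hE hQ.
have cD : (1 - eps) * #|U|%:R <= #|U :\: E|%:R.
  have h1 : #|U :&: E|%:R <= #|E|%:R :> R.
    by rewrite ler_nat subset_leq_card ?subsetIr.
  have := congr1 (fun k => k%:R : R) (cardsID E U); rewrite natrD => h2.
  lra.
have uR : 0 < #|U|%:R :> R by rewrite ltr0n.
have D0 : (0 < #|U :\: E|)%N.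
  rewrite -(ltr0n R); apply: lt_le_trans cD; rewrite mulr_gt0 //; lra.
have [/exists_inP[x xD Qx]|] := boolP [exists x in U :\: E, Q x <= c].
  by exists x.
move=> /exists_inPn none; exfalso; move: hQ; apply/negP; rewrite -ltNge.
apply: (@le_lt_trans _ _ (\sum_(x in U :\: E) c)).
  by rewrite sumr_const -[leRHS]mulr_natl ler_wpM2r.
apply: (@lt_le_trans _ _ (\sum_(x in U :\: E) Q x)).
  have /card_gt0P [x0 x0D] := D0.
  rewrite (big_setD1 x0) //= [ltRHS](big_setD1 x0) //= ltr_leD //.
    by rewrite ltNge none.
  by apply: ler_sum => x /setD1P[_ xD]; rewrite ltW // ltNge none.
rewrite [leRHS](big_setID E) /= -[leLHS]add0r lerD //.
by apply: sumr_ge0 => x /setIP[xU _]; apply: Q0.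
Qed.

End Embedding.

(** * Vertex-by-vertex embedding controlled by a density potential *)

Section RegularEmbedding.

Local Open Scope ring_scope.

Variables (R : realFieldType) (T : finType).

Definition potential (m : nat) (U : nat -> {set T}) (r : nat -> nat -> rel T) : R :=
  \sum_(j < m) \sum_(i < j)
    ecount R (r i j) (U i) (U j) / (#|U i|%:R * #|U j|%:R).

Lemma potentialS m U r :
  potential m.+1 U r =
  \sum_(j < m) (ecount R (r 0%N j.+1) (U 0%N) (U j.+1)
      / (#|U 0%N|%:R * #|U j.+1|%:R)
    + \sum_(i < j) ecount R (r i.+1 j.+1) (U i.+1) (U j.+1)
      / (#|U i.+1|%:R * #|U j.+1|%:R)).
Proof.
rewrite /potential big_ord_recl big_ord0 add0r; apply: eq_bigr => j _.
by rewrite big_ord_recl.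
Qed.

Lemma sum_triangle_le (n m : nat) (G : nat -> nat -> R) (e : R) :
  (m <= n)%N -> 0 <= e -> (forall i j, (i < j)%N -> (j < m)%N -> G i j <= e) ->
  \sum_(j < m) \sum_(i < j) G i j <= n%:R ^+ 2 * e.
Proof.
move=> mn e0 hG; apply: (@le_trans _ _ (\sum_(j < m) n%:R * e)).
  apply: ler_sum => j _; apply: (@le_trans _ _ (\sum_(i < j) e)).
    by apply: ler_sum => i _; exact: hG.
  rewrite sumr_const card_ord -[leLHS]mulr_natl ler_wpM2r // ler_nat.
  exact: leq_trans (ltnW (ltn_ord j)) mn.
rewrite sumr_const card_ord -[leLHS]mulr_natl mulrA expr2 ler_wpM2r //.
by rewrite ler_wpM2r ?ler0n // ler_nat.
Qed.

Section Embed.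

Variables (n0 : nat) (eps lam beta u : R).
Hypotheses (n0_gt0 : (0 < n0)%N) (epsE : eps * (32 * n0%:R) = 1)
  (lam0 : 0 < lam) (lam1 : lam <= 1) (beta0 : 0 <= beta) (u0 : 0 < u)
  (betaE : beta <= eps ^+ 6 * lam ^+ 7 * u ^+ 2).

Let n0R : 1 <= n0%:R :> R. Proof. by rewrite ler1n. Qed.

Let eps0 : 0 < eps.
Proof.
have h : 0 < 32 * n0%:R :> R by rewrite mulr_gt0 ?ltr0n.
by rewrite -(pmulr_lgt0 _ h) epsE.
Qed.

Let eps32 : eps <= 1 / 32.
Proof.
have : 0 <= eps * (n0%:R - 1) by rewrite mulr_ge0 ?subr_ge0 ?(ltW eps0).
by have := epsE; rewrite mulrBr; lra.
Qed.

(* The ratio of consecutive thresholds is 1 + 1 / (n0 + m) >= 1 + 16 * eps, which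
   leaves room for the growth of the potential in one step. *)
Definition threshold (m : nat) : R := eps * lam / 2 * (n0%:R / (n0 + m)%:R).

Lemma threshold_le m : threshold m <= eps * lam / 2.
Proof.
rewrite /threshold ger_pMr ?divr_gt0 ?mulr_gt0 //.
rewrite ler_pdivrMr ?ltr0n ?addn_gt0 ?n0_gt0 // mul1r ler_nat; exact: leq_addr.
Qed.

Lemma threshold_ge m : (m <= n0)%N -> eps * lam / 4 <= threshold m.
Proof.
move=> mn; have -> : eps * lam / 4 = eps * lam / 2 * (1 / 2) by field.
rewrite /threshold ler_wpM2l ?divr_ge0 ?mulr_ge0 ?(ltW eps0) ?(ltW lam0) //.
rewrite ler_pdivlMr ?ltr0n ?addn_gt0 ?n0_gt0 // natrD.
have : m%:R <= n0%:R :> R by rewrite ler_nat.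
lra.
Qed.

(** The factor [1 + 3 * eps] is the growth on average together with the error term, [1 - eps] pays
    for discarded exceptional vertices, and [(1 - 2 * eps) ^+ 2] for the smaller denominators of the
    new densities. *)
Lemma threshold_step m : (m.+1 <= n0)%N ->
  (1 + 3 * eps) * threshold m.+1
  <= (1 - eps) * (1 - 2 * eps) ^+ 2 * threshold m.
Proof.
move=> mn; have mR : m%:R + 1 <= n0%:R :> R by rewrite natr1 ler_nat.
have m0 : 0 <= m%:R :> R by rewrite ler0n.
have s0 : 0 < (n0 + m)%:R :> R by rewrite ltr0n addn_gt0 n0_gt0.
have -> : threshold m = (1 + ((n0 + m)%:R)^-1) * threshold m.+1.
  rewrite /threshold addnS -natr1; field.
  by apply/andP; split; lra.
have t0 : 0 <= threshold m.+1.
  by apply: le_trans (threshold_ge mn); rewrite divr_ge0 ?mulr_ge0 ?ltW.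
have hs : 16 * eps <= ((n0 + m)%:R)^-1.
  rewrite -[leRHS]div1r ler_pdivlMr // natrD.
  have : 0 <= eps * (n0%:R - m%:R) by rewrite mulr_ge0 ?subr_ge0 ?(ltW eps0) //; lra.
  by have := epsE; rewrite mulrBr; lra.
rewrite [leRHS]mulrA ler_wpM2r //.
apply: (@le_trans _ _ ((1 - eps) * (1 - 2 * eps) ^+ 2 * (1 + 16 * eps))); last first.
  rewrite ler_wpM2l ?lerD2l // mulr_ge0 ?sqr_ge0 //; have := eps32; lra.
have h1 : 0 <= eps * (1 / 32 - eps) by rewrite mulr_ge0 ?subr_ge0 ?(ltW eps0).
have := mulr_ge0 h1 (ltW eps0); have := mulr_ge0 h1 (exprn_ge0 2 (ltW eps0)).
have := exprn_ge0 2 (ltW eps0); have := exprn_ge0 3 (ltW eps0).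
by have := eps0; lra.
Qed.

(* Vertices are embedded one at a time; the potential is the total density of
   forbidden pairs between the sets of remaining candidates.  On average over
   the choice of x in U 0 it grows by a factor 1 + O(eps) only, because almost all
   pairs of candidates have about lam ^ 2 * #|U 0| common neighbours in U 0.  The
   terms of Q x with index 0 bound the candidates lost as forbidden for x. *)
Lemma regular_embedding (m : nat) (U : nat -> {set T})
    (nb r : nat -> nat -> rel T) (x0 : T) :
  (m <= n0)%N ->
  (forall i j, symmetric (nb i j)) ->
  (forall i j, pseudorandom lam beta (nb i j)) ->
  (forall i, (i < m)%N -> (2 / lam) ^+ m * u <= #|U i|%:R) ->
  potential m U r <= threshold m ->
  exists x : nat -> T, (forall i, (i < m)%N -> x i \in U i) /\
    (forall i j, (i < j)%N -> (j < m)%N -> nb i j (x i) (x j) /\ ~~ r i j (x i) (x j)).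
Proof.
elim: m U nb r => [|m IH] U nb r mn nbC nbP hU hpot; first by exists (fun=> x0).
have [hl0 hl1 he0 he32] := And4 lam0 lam1 eps0 eps32.
have l2 : 1 <= 2 / lam by rewrite ler_pdivlMr // mul1r; lra.
have uU i : (i < m.+1)%N -> u <= #|U i|%:R.
  move=> im; apply: le_trans (hU _ im); rewrite ler_peMl ?(ltW u0) //.
  exact: exprn_ege1.
have U0 i : (i < m.+1)%N -> 0 < #|U i|%:R :> R.
  by move=> im; apply: lt_le_trans (uU _ im).
set u0' : R := #|U 0%N|%:R; have u0'0 : 0 < u0' by apply: U0.
set phi := threshold m.+1.
have phi_ge : eps * lam / 4 <= phi by exact: threshold_ge.
have phi_le : phi <= eps * lam / 2 by exact: threshold_le.
have phi0 : 0 < phi by apply: lt_le_trans phi_ge; rewrite divr_gt0 ?mulr_gt0.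
pose N i x := [set z in U i | nb 0%N i x z].
(* [Q x] predicts the potential after choosing [x], with the new candidate sets replaced by the
   neighbourhoods [N] and their sizes by the typical values [lam * #|U i.+1|]. *)
pose Q x : R := \sum_(j < m)
  ((\sum_(y in U j.+1) (r 0%N j.+1 x y)%:R) / #|U j.+1|%:R
   + \sum_(i < j) ecount R (r i.+1 j.+1) (N i.+1 x) (N j.+1 x)
      / (lam ^+ 2 * (#|U i.+1|%:R * #|U j.+1|%:R))).
have Q0 x : 0 <= Q x.
  apply: sumr_ge0 => j _; rewrite addr_ge0 ?divr_ge0 ?ler0n //.
    by apply: sumr_ge0 => y _; rewrite ler0n.
  apply: sumr_ge0 => i _.
  by rewrite divr_ge0 ?ecount_ge0 ?mulr_ge0 ?ler0n ?exprn_ge0 ?ltW.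
(* The error term of [codegree_sum], divided by [lam ^+ 2] and both set sizes, is at most this:
   [betaE] bounds [beta], and all sets have size at least [u]. *)
pose err : R := 2 * eps ^+ 4 * lam * u.
have err0 : 0 <= err by rewrite /err !mulr_ge0 ?exprn_ge0 ?ltW.
have n0eps : n0%:R ^+ 2 * err <= eps * phi * u.
  have -> : n0%:R ^+ 2 * err = (eps * (32 * n0%:R)) ^+ 2 * (eps ^+ 2 * lam / 512 * u).
    by rewrite /err; field.
  rewrite epsE expr1n mul1r ler_wpM2r ?(ltW u0) //.
  apply: le_trans (ler_wpM2l (ltW eps0) phi_ge).
  have : 0 <= eps * eps * lam by rewrite !mulr_ge0 ?(ltW lam0) ?(ltW eps0).
  by lra.
have sumQ : \sum_(x in U 0%N) Q x <= (1 - eps) * u0' * ((1 + 3 * eps) / (1 - eps) * phi).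
  have -> : (1 - eps) * u0' * ((1 + 3 * eps) / (1 - eps) * phi)
     = u0' * ((1 + 2 * eps) * phi) + u0' * (eps * phi).
    by field; lra.
  rewrite exchange_big /=.
  pose D i j : R := ecount R (r i j) (U i) (U j) / (#|U i|%:R * #|U j|%:R).
  have D0 i j : 0 <= D i j by rewrite divr_ge0 ?ecount_ge0 ?mulr_ge0 ?ler0n.
  apply: (@le_trans _ _ (\sum_(j < m)
      (u0' * ((1 + 2 * eps) * (D 0%N j.+1 + \sum_(i < j) D i.+1 j.+1))
       + \sum_(i < j) err))).
    apply: ler_sum => j _; rewrite big_split /= !mulrDr -addrA lerD //.
      have -> : \sum_(x in U 0%N)
           (\sum_(y in U j.+1) (r 0%N j.+1 x y)%:R) / #|U j.+1|%:R = u0' * D 0%N j.+1.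
        rewrite -mulr_suml /D /ecount -/u0'; field.
        by have := U0 j.+1 (ltn_ord j : (j.+1 < m.+1)%N); lra.
      by rewrite ler_wpM2l ?(ltW u0'0) // ler_peMl // lerDl mulr_ge0 ?(ltW eps0).
    rewrite exchange_big /= !mulr_sumr -big_split /=; apply: ler_sum => i _.
    have Uj := U0 j.+1 (ltn_ord j : (j.+1 < m.+1)%N).
    have im : (i.+1 < m.+1)%N by exact: ltn_trans (ltn_ord i) (ltn_ord j).
    have Ui := U0 i.+1 im.
    have p0 : 0 < lam ^+ 2 * (#|U i.+1|%:R * #|U j.+1|%:R) :> R.
      by rewrite !mulr_gt0 ?exprn_gt0.
    rewrite -mulr_suml ler_pdivrMr //.
    have U0n : (0 < #|U 0%N|)%N by rewrite -(ltr0n R).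
    apply: le_trans (codegree_sum (r i.+1 j.+1) (U i.+1) (U j.+1) lam0 eps0 beta0 U0n
       (nbP 0%N i.+1) (nbP 0%N j.+1) lam1) _.
    rewrite [leRHS]mulrDl lerD //.
      rewrite /D -/u0' le_eqVlt; apply/orP; left; apply/eqP; field.
      by apply/andP; split; lra.
    have b1 : beta / (eps ^+ 2 * lam ^+ 4) <= eps ^+ 4 * lam ^+ 3 * u ^+ 2.
      rewrite ler_pdivrMr ?mulr_gt0 ?exprn_gt0 //; apply: le_trans betaE _.
      by rewrite le_eqVlt; apply/orP; left; apply/eqP; ring.
    have s0 : 0 <= #|U i.+1|%:R + #|U j.+1|%:R :> R by lra.
    apply: le_trans (ler_wpM2r s0 b1) _.
    have -> : err * (lam ^+ 2 * (#|U i.+1|%:R * #|U j.+1|%:R))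
      = eps ^+ 4 * lam ^+ 3 * u * (2 * (#|U i.+1|%:R * #|U j.+1|%:R)).
      by rewrite /err; ring.
    have -> : eps ^+ 4 * lam ^+ 3 * u ^+ 2 * (#|U i.+1|%:R + #|U j.+1|%:R)
      = eps ^+ 4 * lam ^+ 3 * u * (u * #|U i.+1|%:R + u * #|U j.+1|%:R) by ring.
    rewrite ler_wpM2l ?mulr_ge0 ?exprn_ge0 ?(ltW lam0) ?(ltW eps0) ?(ltW u0) //.
    have h1 := ler_wpM2r (ltW Ui) (uU j.+1 (ltn_ord j : (j.+1 < m.+1)%N)).
    have h2 := ler_wpM2r (ltW Uj) (uU i.+1 im).
    by lra.
  rewrite big_split /= -mulr_sumr -mulr_sumr lerD //.
    rewrite ler_wpM2l ?(ltW u0'0) // ler_wpM2l ?addr_ge0 ?mulr_ge0 ?(ltW eps0) //.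
    by apply: le_trans hpot; rewrite potentialS.
  apply: le_trans (sum_triangle_le (G := fun _ _ => err) (ltnW mn) err0 _) _ => //.
  apply: le_trans n0eps _; rewrite mulrC.
  apply: ler_wpM2r (mulr_ge0 (ltW eps0) (ltW phi0)) _ _ _.
  exact: uU.
pose Ej j := [set x | eps * lam * #|U j.+1|%:R <=
  `|deg R (nb 0%N j.+1) (U j.+1) x - lam * #|U j.+1|%:R|].
pose E := \bigcup_(j < m) Ej j.
(* By [betaE] each [Ej j] has at most [eps ^+ 4 * lam ^+ 5 * u] elements, and there are [m] such
   sets with [m * eps <= 1]. *)
have cE : #|E|%:R <= eps * u0'.
  apply: (@le_trans _ _ (\sum_(j < m) #|Ej j|%:R)).
    rewrite -natr_sum ler_nat /E; elim/big_rec2: _ => [|j k A _ IHs].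
      by rewrite cards0.
    by apply: leq_trans (leq_card_setU _ _) _; rewrite leq_add2l.
  apply: (@le_trans _ _ (\sum_(j < m) eps ^+ 4 * lam ^+ 5 * u)).
    apply: ler_sum => j _.
    have Uj := U0 j.+1 (ltn_ord j : (j.+1 < m.+1)%N).
    have uj := uU j.+1 (ltn_ord j : (j.+1 < m.+1)%N).
    have k0 : 0 <= eps * lam * #|U j.+1|%:R by rewrite !mulr_ge0 ?ltW.
    have := nbP 0%N j.+1 (U j.+1) _ k0; rewrite -/(Ej j) => h.
    have p0 : 0 < eps ^+ 2 * lam ^+ 2 * #|U j.+1|%:R ^+ 2 :> R.
      by rewrite !mulr_gt0 ?exprn_gt0.
    rewrite -(ler_pM2r p0).
    have -> : #|Ej j|%:R * (eps ^+ 2 * lam ^+ 2 * #|U j.+1|%:R ^+ 2)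
      = #|Ej j|%:R * (eps * lam * #|U j.+1|%:R) ^+ 2 :> R by ring.
    apply: le_trans h _; apply: le_trans (ler_wpM2r (ltW Uj) betaE) _.
    have -> : eps ^+ 4 * lam ^+ 5 * u * (eps ^+ 2 * lam ^+ 2 * #|U j.+1|%:R ^+ 2)
      = eps ^+ 6 * lam ^+ 7 * u * #|U j.+1|%:R * #|U j.+1|%:R by ring.
    rewrite ler_wpM2r ?(ltW Uj) // expr2 mulrA ler_wpM2l //.
    by rewrite !mulr_ge0 ?exprn_ge0 ?(ltW lam0) ?(ltW eps0) ?(ltW u0).
  rewrite sumr_const card_ord -[leLHS]mulr_natl.
  have l5 : lam ^+ 5 <= 1 by rewrite exprn_ile1 ?(ltW lam0).
  have mR : m%:R <= n0%:R :> R by rewrite ler_nat ltnW.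
  have h1 : m%:R * eps <= 1.
    have : 0 <= eps * (n0%:R - m%:R) by rewrite mulr_ge0 ?subr_ge0 ?(ltW eps0).
    have : 0 <= eps * n0%:R by rewrite mulr_ge0 ?ler0n ?(ltW eps0).
    by have := epsE; rewrite mulrBr; lra.
  have e3 : eps ^+ 3 <= eps.
    rewrite exprS ler_piMr ?(ltW eps0) // exprn_ile1 ?(ltW eps0) //.
    by have := eps32; lra.
  have -> : m%:R * (eps ^+ 4 * lam ^+ 5 * u) = (m%:R * eps) * (eps ^+ 3 * (lam ^+ 5 * u)).
    by ring.
  apply: (@le_trans _ _ (1 * (eps ^+ 3 * (lam ^+ 5 * u)))).
    by rewrite ler_wpM2r ?mulr_ge0 ?exprn_ge0 ?(ltW lam0) ?(ltW eps0) ?(ltW u0).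
  rewrite mul1r; apply: ler_pM => //.
  - by rewrite exprn_ge0 ?(ltW eps0).
  - by rewrite mulr_ge0 ?exprn_ge0 ?(ltW lam0) ?(ltW u0).
  apply: (@le_trans _ _ u); last by apply: (uU 0%N).
  by rewrite ger_pMl.
have c0 : 0 <= (1 + 3 * eps) / (1 - eps) * phi.
  rewrite mulr_ge0 ?(ltW phi0) // divr_ge0 //; have := eps0; have := eps32; lra.
have eps1 : eps < 1 by have := eps32; lra.
have U0n : (0 < #|U 0%N|)%N by rewrite -(ltr0n R).
have [x /setDP[xU xE] Qx] :=
  exists_le_average (fun x _ => Q0 x) c0 eps1 U0n cE sumQ.
have c_le : (1 + 3 * eps) / (1 - eps) * phi <= eps * lam.
  apply: le_trans (_ : 2 * phi <= _); last by lra.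
  rewrite ler_wpM2r ?(ltW phi0) // ler_pdivrMr; have := eps32; lra.
pose U' j := [set y in U j.+1 | nb 0%N j.+1 x y && ~~ r 0%N j.+1 x y].
(* A share [eps * lam] of [U j.+1] is allowed for the degree deviation of [x], and as much for
   candidates forbidden for [x], whose density is one of the summands of [Q x]. *)
have cU' j : (j < m)%N -> (1 - 2 * eps) * lam * #|U j.+1|%:R <= #|U' j|%:R.
  move=> jm.
  have Uj := U0 j.+1 (jm : (j.+1 < m.+1)%N).
  have dj : lam * #|U j.+1|%:R - eps * lam * #|U j.+1|%:R
      <= \sum_(y in U j.+1) (nb 0%N j.+1 x y)%:R.
    have : x \notin Ej j.
      apply: contra xE => xEj; apply/bigcupP; exists (Ordinal jm) => //.
    rewrite inE -ltNge ltr_distl => /andP[h _]; apply: le_trans (ltW h) _.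
    by rewrite le_eqVlt; apply/orP; left; apply/eqP; apply: eq_bigr => y _; rewrite nbC.
  have rj : \sum_(y in U j.+1) (r 0%N j.+1 x y)%:R <= eps * lam * #|U j.+1|%:R.
    rewrite -ler_pdivrMr //; apply: le_trans c_le; apply: le_trans Qx.
    rewrite /Q (bigD1 (Ordinal jm)) //= -[leLHS]addr0 lerD //.
      rewrite -[leLHS]addr0 lerD //; apply: sumr_ge0 => i _.
      by rewrite divr_ge0 ?ecount_ge0 ?mulr_ge0 ?ler0n ?exprn_ge0 ?(ltW lam0).
    apply: sumr_ge0 => i _; rewrite addr_ge0 ?divr_ge0 ?ler0n //.
      by apply: sumr_ge0 => y _; rewrite ler0n.
    apply: sumr_ge0 => k _.
    by rewrite divr_ge0 ?ecount_ge0 ?mulr_ge0 ?ler0n ?exprn_ge0 ?(ltW lam0).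
  have : \sum_(y in U j.+1) (nb 0%N j.+1 x y)%:R
      <= \sum_(y in U j.+1) (r 0%N j.+1 x y)%:R + #|U' j|%:R :> R.
    rewrite -natr_cond_card -big_split /=; apply: ler_sum => y _.
    by case: (nb _ _ _ _); case: (r _ _ _ _) => //=; rewrite ?addr0 ?add0r ?lexx ?ler01 // lerDl.
  lra.
have [||||| y [yU yR]] := IH U' (fun i j => nb i.+1 j.+1) (fun i j => r i.+1 j.+1).
- exact: ltnW.
- by move=> i j; exact: nbC.
- by move=> i j; exact: nbP.
(* Since [1 - 2 * eps >= 1 / 2], sizes shrink at worst by [lam / 2], exactly the factor released
   when the exponent of [2 / lam] drops by one. *)
- move=> i im; apply: le_trans (cU' i im).
  have Ui := hU i.+1 (im : (i.+1 < m.+1)%N).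
  apply: (@le_trans _ _ (lam / 2 * #|U i.+1|%:R)).
    have -> : (2 / lam) ^+ m * u = lam / 2 * ((2 / lam) ^+ m.+1 * u).
      by rewrite exprS; field; lra.
    by rewrite ler_wpM2l // divr_ge0 ?(ltW lam0).
  rewrite ler_wpM2r ?ler0n //.
  have : 0 <= lam * (1 / 32 - eps) by rewrite mulr_ge0 ?subr_ge0 ?(ltW lam0).
  by lra.
- have e2 : 0 < (1 - 2 * eps) ^+ 2 by rewrite exprn_gt0 //; have := eps32; lra.
  have e1 : 0 < 1 - eps by lra.
  have := threshold_step mn; rewrite -/phi => ts.
  (* [U' i] lies in [N i.+1 x] and has at least [(1 - 2 * eps) * lam * #|U i.+1|] elements, so
     passing from predicted to actual densities costs at most this square. *)
  apply: (@le_trans _ _ (Q x / (1 - 2 * eps) ^+ 2)); last first.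
    rewrite ler_pdivrMr //; apply: le_trans Qx _.
    rewrite mulrAC ler_pdivrMr //; apply: le_trans ts _.
    by rewrite le_eqVlt; apply/orP; left; apply/eqP; ring.
  rewrite /potential /Q mulr_suml; apply: ler_sum => j _.
  rewrite mulrDl -[leLHS]add0r lerD //.
    rewrite !divr_ge0 ?ler0n ?(ltW e2) //.
    by apply: sumr_ge0 => y _; rewrite ler0n.
  rewrite mulr_suml; apply: ler_sum => i _.
  have jm := ltn_ord j.
  have im : (i < m)%N by exact: ltn_trans (ltn_ord i) jm.
  have Uj := U0 j.+1 (jm : (j.+1 < m.+1)%N).
  have Ui := U0 i.+1 (im : (i.+1 < m.+1)%N).
  have l0 : 0 < (1 - 2 * eps) * lam by rewrite mulr_gt0 //; have := eps32; lra.
  have Ui' : 0 < #|U' i|%:R :> R by apply: lt_le_trans (cU' i im); rewrite mulr_gt0.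
  have Uj' : 0 < #|U' j|%:R :> R by apply: lt_le_trans (cU' j jm); rewrite mulr_gt0.
  rewrite -mulrA -invfM; apply: ler_pM; rewrite ?ecount_ge0 //.
  + by rewrite invr_ge0 mulr_ge0 ?ler0n.
  + apply: ecount_sub => //; apply/subsetP => z; rewrite !inE => /andP[-> /andP[-> _]] //.
  have f0 : 0 < 1 - 2 * eps by lra.
  rewrite lef_pV2 ?posrE ?mulr_gt0 ?exprn_gt0 //.
  apply: le_trans (ler_pM _ _ (cU' i im) (cU' j jm)); first last.
  - exact: mulr_ge0 (ltW l0) (ler0n _ _).
  - exact: mulr_ge0 (ltW l0) (ler0n _ _).
  by rewrite le_eqVlt; apply/orP; left; apply/eqP; ring.
exists (fun i => if i is k.+1 then y k else x); split.
  by case=> [|i] // im; have := yU i im; rewrite inE => /andP[].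
case=> [|i] [|j] // ij jm; last exact: (yR i j ij jm).
by have := yU j jm; rewrite inE => /andP[_ /andP[]].
Qed.

End Embed.

End RegularEmbedding.

(** * Sparse pairs from a failed greedy embedding *)

Section SparseParts.

Local Open Scope ring_scope.

Variables (R : realFieldType) (T : finType).

(** If some [x] in [U 0] keeps a share [del] of every later set, recursion continues inside its
    neighbourhoods. Otherwise every [x] fails for some [j]; a most popular [j] collects at least a
    share [1 / n] of [U 0], which serves as [A], with the whole of [U j.+1] as [B]. *)
Lemma greedy_or_sparse (del : R) (n : nat) (x0 : T) (m : nat)
    (U : nat -> {set T}) (g : nat -> nat -> rel T) (c : R) :
  0 < del -> del <= 1 -> (m <= n)%N -> 0 < c -> (forall i, (i < m)%N -> c <= #|U i|%:R) ->
  (exists x : nat -> T, (forall i, (i < m)%N -> x i \in U i) /\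
    forall i j, (i < j)%N -> (j < m)%N -> g i j (x i) (x j)) \/
  exists i j (A B : {set T}), [/\ (i < j)%N, (j < m)%N, A \subset U i & B \subset U j] /\
    [/\ del ^+ m * c <= n%:R * #|A|%:R, del ^+ m * c <= #|B|%:R &
        {in A, forall x, \sum_(y in B) (g i j x y)%:R <= del * #|B|%:R}].
Proof.
move=> del0 del1.
elim: m U g c => [|m IH] U g c mn c0 hU; first by left; exists (fun=> x0).
have dm0 : 0 <= del ^+ m by rewrite exprn_ge0 ?(ltW del0).
pose Nb x j := [set y in U j.+1 | g 0%N j.+1 x y].
have [/exists_inP[x xU /forallP hx]|] :=
  boolP [exists x in U 0%N, forall j : 'I_m, del * #|U j.+1|%:R <= #|Nb x j|%:R].
  have c'0 : 0 < del * c by rewrite mulr_gt0.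
  have hU' i : (i < m)%N -> del * c <= #|Nb x i|%:R.
    move=> im; apply: le_trans (hx (Ordinal im)).
    by rewrite ler_pM2l // hU.
  have NbU i : Nb x i \subset U i.+1 by apply/subsetP=> y; rewrite inE => /andP[].
  have [[y [yU yg]]|[i [j [A [B [[ij jm sA sB] [hA hB hAB]]]]]]] :=
    IH (Nb x) (fun i j => g i.+1 j.+1) _ (ltnW mn) c'0 hU'.
    left; exists (fun i => if i is k.+1 then y k else x); split.
      by case=> [|i] // im; have := yU i im; rewrite inE => /andP[].
    case=> [|i] [|j] // ij jm; last exact: (yg i j ij jm).
    by have := yU j jm; rewrite inE => /andP[].
  right; exists i.+1, j.+1, A, B; split.
    by split=> //; [exact: subset_trans sA _|exact: subset_trans sB _].
  by rewrite exprSr -mulrA.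
move/exists_inPn => none; right.
pose A j := [set x in U 0%N | #|Nb x j|%:R < del * #|U j.+1|%:R].
have cover : (#|U 0%N| <= \sum_(j < m) #|A j|)%N.
  have sU : U 0%N \subset \bigcup_(j < m) A j.
    apply/subsetP => x xU; have := none x xU; rewrite negb_forall => /existsP[j].
    by rewrite -ltNge => hj; apply/bigcupP; exists j; rewrite // inE xU.
  apply: leq_trans (subset_leq_card sU) _.
  elim/big_rec2: _ => [|j k B _ IHs]; first by rewrite cards0.
  by apply: leq_trans (leq_card_setU _ _) _; rewrite leq_add2l.
have U0 : (0 < #|U 0%N|)%N by rewrite -(ltr0n R); apply: lt_le_trans (hU _ _).
have [/existsP[j hj]|] := boolP [exists j : 'I_m, #|U 0%N| <= n * #|A j|]%N.
  have dm : del ^+ m.+1 * c <= c by rewrite ler_piMl ?(ltW c0) // exprn_ile1 ?(ltW del0).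
  exists 0%N, j.+1, (A j), (U j.+1); split.
    by split=> //; [exact: (ltn_ord j)|apply/subsetP => x; rewrite inE => /andP[]].
  split; first 2 last.
  - by move=> x; rewrite inE natr_cond_card => /andP[_ /ltW].
  - apply: le_trans dm _; apply: le_trans (hU 0%N isT) _.
    by rewrite -natrM ler_nat.
  - by apply: le_trans dm _; apply: hU; exact: (ltn_ord j).
(* If every [n * #|A j|] were below [#|U 0|], summing over [m < n] indices could not reach
   [n * #|U 0|], contrary to [cover]. *)
rewrite negb_exists => /forallP hno; exfalso.
have : (n * #|U 0%N| <= \sum_(j < m) #|U 0%N|.-1)%N.
  apply: leq_trans (leq_mul (leqnn n) cover) _; rewrite big_distrr /=.
  by apply: leq_sum => j _; have := hno j; rewrite -ltnNge; case: #|U 0%N|.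
rewrite sum_nat_const card_ord; case: #|U 0%N| U0 => // k _ /=.
nia.
Qed.

(* A failed greedy embedding in W gives A and B with few pairs in the class of
   w1 := rcons w (a i j).  Splitting A refines w1 to w1 ++ v1; almost all vertices of
   B keep a low degree to every part of A, and splitting those with respect to
   w1 ++ v1 refines the word again, so that one word serves all pairs of parts. *)
Lemma sparse_parts (red : seq nat -> rel T) (n M : nat) (a : nat -> nat -> nat)
    (del del' : R) (x0 : T) :
  0 < del -> del * n%:R <= 1 -> 0 < del' -> del' <= 1 -> (0 < n)%N ->
  (forall w v x y, red (w ++ v) x y -> red w x y) ->
  (forall i j, a i j < M)%N ->
  (forall w, all (gtn M) w -> ~ exists x : nat -> T,
     forall i j, (i < j)%N -> (j < n)%N -> red (rcons w (a i j)) (x i) (x j)) ->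
  forall k, del * 2 ^+ k.+1 <= del' ->
  forall (W : {set T}) (w : seq nat), (0 < #|W|)%N -> all (gtn M) w ->
  exists (v : seq nat) (U : nat -> {set T}),
  [/\ size v = (2 ^ k).-1, all (gtn M) v,
      forall i, (i < 2 ^ k)%N -> U i \subset W,
      forall i, (i < 2 ^ k)%N -> del ^+ (n.+1 * k) * #|W|%:R <= #|U i|%:R
    & forall i j, (i < j)%N -> (j < 2 ^ k)%N ->
        ecount R (red (w ++ v)) (U i) (U j) <= del' * (#|U i|%:R * #|U j|%:R)].
Proof.
move=> del0 deln del'0 del'1 n0 mono aM none; elim=> [|k IH] hk W w W0 wM.
  exists [::], (fun=> W); split=> // [i _|i j].
    by rewrite muln0 expr0 mul1r.
  by move=> ij; rewrite expn0 ltnS leqn0 => /eqP j0; rewrite j0 in ij.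
have WR : 0 < #|W|%:R :> R by rewrite ltr0n.
have hk' : del * 2 ^+ k.+1 <= del'.
  apply: le_trans hk; rewrite ler_pM2l // [leRHS]exprS ler_peMl ?exprn_ge0 //.
  by rewrite ler1n.
have del2 : del * 2 <= 1.
  apply: le_trans del'1; apply: le_trans hk; rewrite ler_pM2l //.
  by rewrite exprS ler_peMr // exprn_ege1 // ler1n.
have del1 : del <= 1 by lra.
have [[x [_ hx]]|] := greedy_or_sparse x0 (fun i j => red (rcons w (a i j)))
  del0 del1 (leqnn n) WR (fun i _ => lexx #|W|%:R).
  by case: (none w wM); exists x.
move=> [i0 [j0 [A [B [[ij jn sA sB] [cA cB hAB]]]]]].
set w1 := rcons w (a i0 j0) in hAB.
have w1M : all (gtn M) w1 by rewrite /w1 all_rcons wM /= aM.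
(* One factor [del] beyond [del ^+ n] is spent twice: for [A] it absorbs the loss [1 / n], for [B]
   the loss of a half when bad vertices are removed. *)
pose s : R := del ^+ n.+1 * #|W|%:R.
have s0 : 0 < s by rewrite mulr_gt0 ?exprn_gt0.
have sA' : s <= #|A|%:R.
  have nR : 0 < n%:R :> R by rewrite ltr0n.
  rewrite -(ler_pM2l nR); apply: le_trans cA.
  rewrite /s exprS mulrA mulrA [n%:R * del]mulrC.
  by rewrite ler_wpM2r ?(ltW WR) // ler_piMl ?exprn_ge0 ?(ltW del0).
have A0 : (0 < #|A|)%N by rewrite -(ltr0n R); exact: lt_le_trans sA'.
have [v1 [U1 [sz1 v1M sU1 cU1 dU1]]] := IH hk' A w1 A0 w1M.
have U1R i : (i < 2 ^ k)%N -> 0 < #|U1 i|%:R :> R.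
  move=> ik; apply: lt_le_trans (cU1 i ik).
  by rewrite mulr_gt0 ?exprn_gt0 // ltr0n.
(* Vertices of [A] have density at most [del] into [B], so by double counting [Bad i] is at most a
   share [del / del'] of [B]. As [del * 2 ^+ k.+1 <= del'], the union over the [2 ^ k] parts is at
   most half of [B]. *)
pose Bad i := [set b in B | del' * #|U1 i|%:R < \sum_(x in U1 i) (red w1 x b)%:R].
pose B' := B :\: \bigcup_(i < 2 ^ k) Bad i.
have cBad i : (i < 2 ^ k)%N -> #|Bad i|%:R * del' <= del * #|B|%:R.
  move=> ik; rewrite -(ler_pM2r (U1R i ik)).
  apply: (@le_trans _ _ (\sum_(b in B) \sum_(x in U1 i) (red w1 x b)%:R)).
    apply: (@le_trans _ _ (\sum_(b in Bad i) \sum_(x in U1 i) (red w1 x b)%:R)).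
      rewrite -mulrA mulr_natl -[leLHS]sumr_const; apply: ler_sum => b.
      by rewrite inE => /andP[_ /ltW].
    have sBad : Bad i \subset B by apply/subsetP => b; rewrite inE => /andP[].
    rewrite [leRHS](big_setID (Bad i)) /= (setIidPr sBad) lerDl.
    by apply: sumr_ge0 => b _; apply: sumr_ge0 => x _; rewrite ler0n.
  rewrite exchange_big /= [leRHS]mulr_natr -[leRHS]sumr_const; apply: ler_sum => x xU.
  by apply: hAB; apply: (subsetP (sU1 i ik)).
have cB' : s <= #|B'|%:R.
  have hsum : 2 * #|\bigcup_(i < 2 ^ k) Bad i|%:R <= #|B|%:R :> R.
    have h1 : #|\bigcup_(i < 2 ^ k) Bad i|%:R * del' <= 2 ^+ k * (del * #|B|%:R).
      apply: (@le_trans _ _ ((\sum_(i < 2 ^ k) #|Bad i|)%:R * del')).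
        rewrite ler_wpM2r ?(ltW del'0) // ler_nat.
        elim/big_rec2: _ => [|i m C _ IHs]; first by rewrite cards0.
        by apply: leq_trans (leq_card_setU _ _) _; rewrite leq_add2l.
      rewrite natr_sum mulr_suml.
      apply: (@le_trans _ _ (\sum_(i < 2 ^ k) del * #|B|%:R)).
        by apply: ler_sum => i _; apply: cBad.
      by rewrite sumr_const card_ord -[leLHS]mulr_natl natrX.
    rewrite -(ler_pM2r del'0).
    have h2 := ler_wpM2r (ler0n R #|B|) hk'.
    rewrite exprS in h2; lra.
  have := cardsID (\bigcup_(i < 2 ^ k) Bad i) B => /(congr1 (fun k => k%:R : R)).
  rewrite natrD -/B' => h2.
  have h3 : #|B :&: \bigcup_(i < 2 ^ k) Bad i|%:R <= #|\bigcup_(i < 2 ^ k) Bad i|%:R :> R.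
    by rewrite ler_nat subset_leq_card ?subsetIr.
  have h4 : 2 * s <= #|B|%:R.
    apply: le_trans cB; rewrite /s exprS !mulrA -[leRHS]mul1r !mulrA mul1r.
    by rewrite -[leLHS]mulrA ler_piMl ?mulr_ge0 ?exprn_ge0 ?(ltW del0) ?(ltW WR) // mulrC.
  lra.
have B'0 : (0 < #|B'|)%N by rewrite -(ltr0n R); exact: lt_le_trans cB'.
have w2M : all (gtn M) (w1 ++ v1) by rewrite all_cat w1M.
have [v2 [U2 [sz2 v2M sU2 cU2 dU2]]] := IH hk' B' _ B'0 w2M.
pose U i := if (i < 2 ^ k)%N then U1 i else U2 (i - 2 ^ k)%N.
have vE : w ++ a i0 j0 :: v1 ++ v2 = (w1 ++ v1) ++ v2.
  by rewrite /w1 -cats1 -!catA.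
have ltU2 i : (i < 2 ^ k.+1)%N -> ~~ (i < 2 ^ k)%N -> (i - 2 ^ k < 2 ^ k)%N.
  by move=> ik _; rewrite ltn_psubLR ?expn_gt0 // addnn -mul2n -expnS.
exists (a i0 j0 :: v1 ++ v2), U; split.
- rewrite /= size_cat sz1 sz2 expnS.
  by case: (2 ^ k)%N (expn_gt0 2 k) => // p _; rewrite mul2n doubleS -addnn.
- by rewrite /= aM all_cat v1M.
- move=> i ik; rewrite /U; case: ifPn => ik'.
    exact: subset_trans (sU1 i ik') sA.
  apply: subset_trans (sU2 _ (ltU2 i ik ik')) _.
  exact: subset_trans (subsetDl _ _) sB.
- have dk : del ^+ (n.+1 * k.+1) * #|W|%:R = del ^+ (n.+1 * k) * s.
    by rewrite /s mulrA -exprD -mulnSr.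
  have dk0 : 0 <= del ^+ (n.+1 * k) by rewrite exprn_ge0 ?(ltW del0).
  move=> i ik; rewrite dk /U; case: ifPn => ik'.
    by apply: le_trans (cU1 i ik'); apply: ler_wpM2l.
  by apply: le_trans (cU2 _ (ltU2 i ik ik')); apply: ler_wpM2l.
move=> i j ij' jk; rewrite vE /U.
case: (ifPn (i < 2 ^ k)%N) => ik; case: (ifPn (j < 2 ^ k)%N) => jk'.
- apply: le_trans (dU1 i j ij' jk'); apply: ecount_sub => // x y _ _.
  exact: mono.
(* For mixed pairs the prefix [w1] already suffices: every vertex of the second part avoids
   [Bad i]. *)
- have jk2 := ltU2 j jk jk'.
  apply: (@le_trans _ _ (ecount R (red w1) (U1 i) (U2 (j - 2 ^ k)%N))).
    by apply: ecount_sub => // x y _ _; rewrite -catA; exact: mono.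
  rewrite /ecount exchange_big /= mulrA [leRHS]mulr_natr -[leRHS]sumr_const.
  apply: ler_sum => b bU; have := subsetP (sU2 _ jk2) b bU.
  move=> /setDP[bB bN]; rewrite leNgt; apply: contra bN => hb.
  by apply/bigcupP; exists (Ordinal ik); rewrite // inE bB.
- by case/negP: ik; exact: ltn_trans jk'.
apply: dU2; last exact: ltU2.
by rewrite ltn_sub2r ?(leq_ltn_trans _ ij') // leqNgt.
Qed.

End SparseParts.

(** * Edge-ordered graphs and copies *)

Lemma imset_set2 (S T : finType) (f : S -> T) x y :
  f @: [set x; y] = [set f x; f y].
Proof. by rewrite imsetU1 imset_set1. Qed.

Lemma imset_in_subset (S T : finType) (f : S -> T) (A d e : {set S}) :
  {in A &, injective f} -> d \subset A -> e \subset A ->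
  f @: d \subset f @: e -> d \subset e.
Proof.
move=> inj dA eA sf; apply/subsetP => z zd.
have /(subsetP sf)/imsetP[z' z'e fz] : f z \in f @: d by exact: imset_f.
by rewrite (inj z z' (subsetP dA _ zd) (subsetP eA _ z'e) fz).
Qed.

Lemma imset_in_inj (S T : finType) (f : S -> T) (A d e : {set S}) :
  {in A &, injective f} -> d \subset A -> e \subset A -> f @: d = f @: e -> d = e.
Proof.
move=> inj dA eA E; apply/eqP; rewrite eqEsubset.
by apply/andP; split; apply: (imset_in_subset inj) => //; rewrite E.
Qed.

Section EdgeRank.

Variables (S : finType) (H : eograph S).

Lemma edgeP e : e \in edges H -> exists x y,
  [/\ x != y, e = [set x; y], x \in verts H & y \in verts H].
Proof.
move=> eH; have := edges_verts eH; move: (edges_card2 eH) => /eqP/cards2P.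
move=> [x [y [xy ->]]]; rewrite subUset !sub1set => /andP[xH yH].
by exists x, y.
Qed.

Definition edge_rank (e : {set S}) : nat :=
  #|[set d in edges H | ele H d e & d != e]|.

Lemma edge_rank_lt : {in edges H &, forall d e : {set S},
  d != e -> ele H d e -> edge_rank d < edge_rank e}.
Proof.
move=> d e dH eH de led; apply: proper_card; apply/properP; split; last first.
  by exists d; rewrite inE ?eqxx ?andbF // dH led de.
apply/subsetP => d'; rewrite !inE => /and3P[d'H led' d'd]; rewrite d'H /=.
rewrite (ele_trans dH d'H eH led' led) /=; apply: contra d'd => /eqP d'e.
by move: led'; rewrite d'e eq_sym => led'; apply/eqP/(ele_anti dH eH); rewrite led.
Qed.

Lemma card_edges_le : #|edges H| <= #|verts H| ^ 2.
Proof.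
rewrite -mulnn -cardsX.
apply: leq_trans (leq_imset_card (fun p : S * S => [set p.1; p.2]) _).
apply/subset_leq_card/subsetP => e eH.
have [x [y [xy -> xH yH]]] := edgeP eH.
by apply/imsetP; exists (x, y); rewrite ?inE ?xH ?yH.
Qed.

Lemma edge_rank_bound (e : {set S}) : e \in edges H -> edge_rank e < #|verts H| ^ 2.
Proof.
move=> eH; apply: leq_trans card_edges_le; apply: proper_card.
apply/properP; split; first by apply/subsetP => d; rewrite inE => /andP[].
by exists e; rewrite // inE eqxx !andbF.
Qed.

Lemma edges_neq x y : [set x; y] \in edges H -> x != y.
Proof. by move/edges_card2 => /eqP; rewrite cards2; case: (x != y). Qed.

Lemma colorable_mono j k : colorable H j -> j <= k -> colorable H k.
Proof.
move=> [c [cj cH]] jk; exists c; split=> // x xH; exact: leq_trans (cj x xH) jk.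
Qed.

Lemma chromatic_numberP k : chromatic_number H <= k -> colorable H k.
Proof.
rewrite /chromatic_number; case: ex_minnP => j /asboolP Hj _; exact: colorable_mono.
Qed.

Lemma colorable_card : colorable H #|verts H|.
Proof.
exists (fun x => index x (enum (verts H))); split.
  by move=> x xH; rewrite cardE index_mem mem_enum.
move=> x y xyH; have : [set x; y] \subset verts H by exact: edges_verts.
rewrite subUset !sub1set -[x \in _]mem_enum -[y \in _]mem_enum => /andP[xH yH] E.
by have := edges_neq xyH; rewrite -(nth_index x xH) E nth_index ?eqxx.
Qed.

End EdgeRank.

Lemma exists_subgraph (V : finType) (G : eograph V) (vs : {set V}) (es : {set {set V}}) :
  vs \subset verts G -> es \subset edges G -> {in es, forall e : {set V}, e \subset vs} ->
  exists G' : eograph V, [/\ verts G' = vs, edges G' = es & ele G' = ele G].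
Proof.
move=> svs ses sev; have inG := subsetP ses.
unshelve eexists (@EOGraph V vs es (ele G) _ sev _ _ _ _); last by split.
- by move=> e /inG; exact: edges_card2.
- by move=> e /inG; exact: ele_refl.
- by move=> d e /inG dG /inG; exact: ele_anti.
- by move=> d e f /inG dG /inG eG /inG; exact: ele_trans.
- by move=> d e /inG dG /inG; exact: ele_total.
Qed.

Lemma contains_copy_monochromatic (S V : finType) (H : eograph S) (G G' M : eograph V)
    (c : {set V} -> bool) (b : bool) :
  is_copy H G' G -> colored c b G' -> verts M = verts G ->
  edges M = [set e in edges G | c e == b] -> ele M = ele G -> contains_copy H M.
Proof.
move=> [[sv se sle] eqv] cb vM eM lM; exists G'; split=> //; split.
- by rewrite vM.
- by apply/subsetP => e eG'; rewrite eM inE (subsetP se) //= cb.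
- by rewrite lM.
Qed.

(** Either every member of the family has a red copy, and the red edges work, or some member has
    none; taking it as [H1] forces a blue copy of every other member, and the blue edges work. *)
Lemma arrows_universal (n t : nat) (V : finType) (G : eograph V) :
  (forall (T1 T2 : finType) (H1 : eograph T1) (H2 : eograph T2),
     Fam n H1 -> Famchi n t H2 -> edge_arrows G H1 H2) ->
  ramsey_universal (Famchi n t) G.
Proof.
move=> arr c.
have mono b : exists M : eograph V,
    [/\ verts M = verts G, edges M = [set e in edges G | c e == b] & ele M = ele G].
  apply: exists_subgraph => //; first by apply/subsetP => e; rewrite inE => /andP[].
  by move=> e; rewrite inE => /andP[/edges_verts].
have sub b M : [/\ verts M = verts G, edges M = [set e in edges G | c e == b]
    & ele M = ele G] -> subgraph M G /\ exists b, colored c b M.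
  move=> [vM eM lM]; split; first split; rewrite ?vM ?eM ?lM //.
    by apply/subsetP => e; rewrite inE => /andP[].
  by exists b => e; rewrite eM inE => /andP[_ /eqP].
have [[S [H [HF nored]]]|allred] := pselect (exists (S : finType) (H : eograph S),
    Famchi n t H /\
    ~ exists2 G' : eograph V, is_copy H G' G & colored c true G').
  have [M hM] := mono false; exists M.
  have [sM cM] := sub _ _ hM; split=> // T2 H2 H2F.
  have [//|[G' cp cb]] := arr S T2 H H2 HF.1 H2F c.
  by have [vM eM lM] := hM; apply: contains_copy_monochromatic cp cb vM eM lM.
have [M hM] := mono true; exists M.
have [sM cM] := sub _ _ hM; split=> // S H HF.
have [G' cp cb] : exists2 G' : eograph V, is_copy H G' G & colored c true G'.
  by apply: contrapT => no; apply: allred; exists S, H.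
by have [vM eM lM] := hM; apply: contains_copy_monochromatic cp cb vM eM lM.
Qed.

Lemma edge_arrows_is_r_edge (T1 T2 V : finType) (H1 : eograph T1) (H2 : eograph T2)
    (G : eograph V) :
  edge_arrows G H1 H2 -> exists2 N, is_r_edge H1 H2 N & N <= #|verts G|.
Proof.
move=> arr; have ex : exists N, `[< edge_ramsey_order H1 H2 N >].
  by exists #|verts G|; apply/asboolP; exists V, G.
case: (ex_minnP ex) => N /asboolP hN minN; exists N.
  by split=> // M hM; apply: minN; apply/asboolP.
by apply: minN; apply/asboolP; exists V, G.
Qed.

(** * Cliques ordered by edge labels *)

Section LabelledClique.

Variables (V : finType) (lab : V -> V -> nat).
Hypothesis labC : forall x y, lab x y = lab y x.

(** The maxima turn a symmetric function of two points into a function of a set without choosing an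
    order of its elements. *)
Definition pair_label (e : {set V}) : nat :=
  \max_(x in e) \max_(y in e | y != x) lab x y.

Lemma pair_labelE x y : x != y -> pair_label [set x; y] = lab x y.
Proof.
move=> xy; rewrite /pair_label big_setU1 ?inE //= big_set1.
rewrite big_mkcondr big_setU1 ?inE //= big_set1 eqxx eq_sym xy max0n.
rewrite big_mkcondr big_setU1 ?inE //= big_set1 eqxx xy maxn0.
by rewrite labC maxnn.
Qed.

(* Ties between equal labels are broken by an arbitrary enumeration of the edges. *)
Definition edge_key (e : {set V}) : nat :=
  pair_label e * #|{set V}| + enum_rank e.

Lemma edge_key_inj : injective edge_key.
Proof.
move=> d e E; apply: enum_rank_inj; apply: ord_inj.
have := congr1 (modn^~ #|{set V}|) E.
by rewrite /edge_key !modnMDl !modn_small.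
Qed.

Lemma edge_key_lt d e : pair_label d < pair_label e -> edge_key d < edge_key e.
Proof.
move=> lt; apply: leq_trans (leq_addr _ _).
apply: leq_trans (leq_mul lt (leqnn #|{set V}|)).
by rewrite mulSn [X in _ < X]addnC ltn_add2l.
Qed.

Lemma exists_labelled_clique : exists G : eograph V,
  [/\ verts G = setT, edges G = [set e : {set V} | #|e| == 2]
    & forall d e, ele G d e = (edge_key d <= edge_key e)].
Proof.
unshelve eexists (@EOGraph V setT [set e : {set V} | #|e| == 2]
  (fun d e => edge_key d <= edge_key e) _ _ _ _ _ _); last by split.
- by move=> e; rewrite inE => /eqP.
- by move=> e _; exact: subsetT.
- by move=> e _ /=; exact: leqnn.
- by move=> d e _ _; rewrite -eqn_leq => /eqP/edge_key_inj.
- by move=> d e f _ _ _ /=; exact: leq_trans.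
- by move=> d e _ _; exact: leq_total.
Qed.

(** Division by [B] turns labels into shifted edge ranks, so images of distinct edges have distinct
    labels in the order of [H], and tie-breaking never matters. Only images of edges are kept in the
    copy; pairs of non-adjacent vertices are unrestricted. *)
Lemma copy_of_labels (S : finType) (H : eograph S) (G : eograph V)
    (c : {set V} -> bool) (b : bool) (f : S -> V) (B p : nat) :
  verts G = setT -> edges G = [set e : {set V} | #|e| == 2] ->
  (forall d e, ele G d e = (edge_key d <= edge_key e)) ->
  {in verts H &, injective f} ->
  (forall x y, [set x; y] \in edges H ->
     lab (f x) (f y) %/ B = p + edge_rank H [set x; y] /\ c [set f x; f y] = b) ->
  exists2 G' : eograph V, is_copy H G' G & colored c b G'.
Proof.
move=> vG eG lG finj hf.
have fneq x y : x != y -> x \in verts H -> y \in verts H -> f x != f y.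
  by move=> xy xH yH; apply: contra xy => /eqP/finj ->.
pose es := [set f @: e | e : {set S} in edges H].
have esP e' : e' \in es -> exists2 e, e \in edges H & e' = f @: e.
  by move=> /imsetP[e eH ->]; exists e.
have lab_rank e : e \in edges H -> pair_label (f @: e) %/ B = p + edge_rank H e.
  move=> eH; have [x [y [xy eE xH yH]]] := edgeP eH.
  rewrite eE imset_set2 pair_labelE ?fneq //.
  by rewrite (hf x y _).1 -?eE.
have key_lt d e : d \in edges H -> e \in edges H -> d != e -> ele H d e ->
    edge_key (f @: d) < edge_key (f @: e).
  move=> dH eH de led; apply: edge_key_lt; rewrite ltnNge; apply/negP.
  move/(leq_div2r B); rewrite !lab_rank // leq_add2l leqNgt.
  by rewrite edge_rank_lt.
have [|||G' [vG' eG' lG']] := @exists_subgraph V G (f @: verts H) es.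
- by rewrite vG subsetT.
- apply/subsetP => e' /esP[e eH ->]; have [x [y [xy -> xH yH]]] := edgeP eH.
  by rewrite eG inE imset_set2 cards2 fneq.
- by move=> e' /esP[e eH ->]; apply: imsetS; exact: edges_verts.
exists G'; last first.
  move=> e'; rewrite eG' => /esP[e eH ->].
  have [x [y [xy eE xH yH]]] := edgeP eH.
  by rewrite eE imset_set2 (hf x y _).2 // -eE.
split.
  split; rewrite ?vG' ?eG' ?lG' //; first by rewrite vG subsetT.
  apply/subsetP => e' /esP[e eH ->]; have [x [y [xy -> xH yH]]] := edgeP eH.
  by rewrite eG inE imset_set2 cards2 fneq.
exists f; split=> //.
  move=> x y xH yH /=; rewrite eG'; apply/idP/idP => [/esP[e eH]|eH]; last first.
    by rewrite -imset_set2; apply/imsetP; exists [set x; y].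
  rewrite -imset_set2 => fe; rewrite (imset_in_inj finj _ _ fe) //.
    by rewrite subUset !sub1set xH yH.
  exact: edges_verts.
move=> d e dH eH /=; rewrite lG' lG.
have [<-|de] := eqVneq d e; first by rewrite leqnn ele_refl.
have [led|nled] := boolP (ele H d e); first by rewrite ltnW ?key_lt.
have /orP[led|led] := ele_total dH eH; first by rewrite led in nled.
by apply/negbTE; rewrite -ltnNge key_lt // eq_sym.
Qed.

End LabelledClique.

(** * Labels as words of digits *)

Section LabelClasses.

(** The class is a block of [B] consecutive ranks, and [p.+1 * B <= #|F|] keeps the block whole. *)
Lemma card_label_class (F : finType) (B p : nat) : 0 < B -> p.+1 * B <= #|F| ->
  #|[set z : F | enum_rank z %/ B == p]| = B.
Proof.
move=> B0 pB.
have lt (j : 'I_B) : p * B + j < #|F|.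
  by apply: leq_trans pB; rewrite mulSn addnC ltn_add2r.
pose h (j : 'I_B) : F := enum_val (Ordinal (lt j)).
have hinj : injective h.
  by move=> i j /enum_val_inj/(congr1 val) /= /addnI/ord_inj.
rewrite -[RHS]card_ord -(card_imset predT hinj); apply: eq_card => z.
rewrite inE; apply/eqP/imsetP => [zp|[j _ ->]]; last first.
  by rewrite /h enum_valK /= divnMDl // divn_small ?addn0.
exists (Ordinal (ltn_pmod (enum_rank z) B0)) => //.
apply: enum_rank_inj; rewrite /h enum_valK; apply: ord_inj => /=.
by rewrite -zp -divn_eq.
Qed.

Definition word_value (M : nat) (w : seq nat) : nat :=
  foldl (fun p a => p * M + a) 0 w.

Lemma word_value_rcons M w a :
  word_value M (rcons w a) = word_value M w * M + a.
Proof. by rewrite /word_value foldl_rcons. Qed.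

Lemma word_value_cat M w v : all (gtn M) v ->
  word_value M (w ++ v) %/ M ^ size v = word_value M w.
Proof.
elim/last_ind: v => [|v a IH]; first by rewrite cats0 divn1.
rewrite all_rcons => /andP[/= aM vM]; rewrite -rcons_cat word_value_rcons size_rcons.
rewrite expnS divnMA divnMDl ?(leq_ltn_trans _ aM) // (divn_small aM) addn0.
exact: IH.
Qed.

Lemma word_value_lt M w : all (gtn M) w -> word_value M w < M ^ size w.
Proof.
elim/last_ind: w => // w a IH; rewrite all_rcons => /andP[/= aM wM].
rewrite word_value_rcons size_rcons expnS mulnC.
apply: leq_trans (leq_mul (leqnn M) (IH wM)).
by rewrite mulnS [M + _]addnC ltn_add2l.
Qed.

End LabelClasses.

Section PatternCopy.

Variables (S : finType) (H : eograph S) (s0 : S).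

Definition vertex_at (i : nat) : S := nth s0 (enum (verts H)) i.

Definition edge_at (i j : nat) : {set S} := [set vertex_at i; vertex_at j].

(** The default 0 on non-edges prescribes a digit for every pair of positions; it is harmless
    because copies need not be induced. *)
Definition label_at (i j : nat) : nat :=
  if edge_at i j \in edges H then edge_rank H (edge_at i j) else 0.

Lemma label_at_lt M i j : 0 < M -> #|verts H| ^ 2 <= M -> label_at i j < M.
Proof.
move=> M0 nM; rewrite /label_at; case: ifP => // ijH.
exact: leq_trans (edge_rank_bound ijH) nM.
Qed.

Lemma copy_of_pattern (V : finType) (lab : V -> V -> nat) (G : eograph V)
    (c : {set V} -> bool) (b : bool) (x : nat -> V) (B p : nat) :
  (forall x y, lab x y = lab y x) ->
  verts G = setT -> edges G = [set e : {set V} | #|e| == 2] ->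
  (forall d e, ele G d e = (edge_key lab d <= edge_key lab e)) ->
  (forall i j, i < j -> j < #|verts H| -> x i != x j) ->
  (forall i j, i < j -> j < #|verts H| -> edge_at i j \in edges H ->
     lab (x i) (x j) %/ B = p + label_at i j /\ c [set x i; x j] = b) ->
  exists2 G' : eograph V, is_copy H G' G & colored c b G'.
Proof.
move=> labC vG eG lG xneq hx; pose ix s := index s (enum (verts H)).
have ixlt s : s \in verts H -> ix s < #|verts H|.
  by move=> sH; rewrite cardE index_mem mem_enum.
have ixK s : s \in verts H -> vertex_at (ix s) = s.
  by move=> sH; rewrite /vertex_at nth_index ?mem_enum.
apply: (copy_of_labels labC (f := fun s => x (ix s)) (B := B) (p := p) vG eG lG).
  move=> s s' sH s'H E; rewrite -(ixK s sH) -(ixK s' s'H).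
  have [lt|lt|->//] := ltngtP (ix s) (ix s').
    by have := xneq _ _ lt (ixlt _ s'H); rewrite E eqxx.
  by have := xneq _ _ lt (ixlt _ sH); rewrite E eqxx.
have base s s' : [set s; s'] \in edges H -> s \in verts H -> s' \in verts H ->
    ix s < ix s' ->
    lab (x (ix s)) (x (ix s')) %/ B = p + edge_rank H [set s; s'] /\
    c [set x (ix s); x (ix s')] = b.
  move=> ssH sH s'H lt; have := hx _ _ lt (ixlt _ s'H).
  by rewrite /label_at /edge_at !ixK // ssH => /(_ isT).
move=> s s' ssH; have : [set s; s'] \subset verts H by exact: edges_verts.
rewrite subUset !sub1set => /andP[sH s'H].
have [lt|lt|E] := ltngtP (ix s) (ix s'); first exact: base.
  have := base s' s; rewrite [[set s'; s]]setUC [[set x (ix s'); _]]setUC.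
  by rewrite (labC (x (ix s'))); exact.
by have := edges_neq ssH; rewrite -(ixK s sH) -(ixK s' s'H) E eqxx.
Qed.

End PatternCopy.

(** * Numerical inequalities between the parameters *)

Section Constants.

Local Open Scope ring_scope.

Variables (R : realFieldType) (B : R) (n k : nat).
Hypotheses (n0 : (0 < n)%N) (k0 : (0 < k)%N) (B16 : 16 <= B)
  (nB : n%:R ^+ 4 <= B).

Let B1 : 1 <= B. Proof. by apply: le_trans B16; rewrite ler1n. Qed.
Let B0 : 0 < B. Proof. by apply: lt_le_trans B1. Qed.
Let nR : 1 <= n%:R :> R. Proof. by rewrite ler1n. Qed.
Let n_le : n%:R <= B.
Proof. by apply: le_trans nB; rewrite -[leLHS]expr1 ler_weXn2l. Qed.
Let n3_le : n%:R ^+ 3 <= B.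
Proof. by apply: le_trans nB; rewrite ler_weXn2l. Qed.
Let B2_256 : 256 <= B ^+ 2.
Proof. by have := B16; have := B1; nra. Qed.

Lemma param_degree : (B ^+ 5)^-1 * n%:R <= 1.
Proof.
rewrite mulrC ler_pdivrMr ?exprn_gt0 // mul1r; apply: le_trans n_le _.
by rewrite -[leLHS]expr1 ler_weXn2l.
Qed.

Lemma param_density : 2 ^+ k.+1 <= B -> (B ^+ 5)^-1 * 2 ^+ k.+1 <= (B ^+ 4)^-1.
Proof.
move=> kB; rewrite mulrC ler_pdivrMr ?exprn_gt0 //.
rewrite [B ^+ 5]exprS mulrCA mulVf ?mulr1 //.
by rewrite expf_neq0 // gt_eqF.
Qed.

(** With [B ^+ (49 * n * k)] the order of the field, the first two factors are the guaranteed size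
    of the sparse parts. The last one reserves room for [n] shrinkings by [lam / 2], where [lam] is
    [B^-1]. *)
Definition min_size : R :=
  (B ^+ 5)^-1 ^+ (n.+1 * k) * (B ^+ (49 * n * k)) ^+ 2 * (B^-1 / 2) ^+ n.

(** Exponents of [B]: from [98 * n * k] at most [10 * n * k] is lost to the powers of [B ^+ 5], and
    at most [2 * n * k] to the last factor since [2 <= B]. *)
Lemma min_size_ge : B ^+ (86 * n * k) <= min_size.
Proof.
rewrite /min_size -mulrA [_ * (_ * _)]mulrC exprVn ler_pdivlMr; last first.
  by rewrite !exprn_gt0.
rewrite -invfM exprVn ler_pdivlMr; last by rewrite exprn_gt0 ?mulr_gt0.
rewrite -!exprM exprMn; apply: (@le_trans _ _
  (B ^+ (86 * n * k) * B ^+ (5 * (n.+1 * k)) * (B ^+ n * B ^+ n))).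
  rewrite ler_wpM2l ?mulr_ge0 ?exprn_ge0 ?(ltW B0) //.
  rewrite ler_wpM2l ?exprn_ge0 ?(ltW B0) // lerXn2r ?nnegrE ?(ltW B0) //.
  by apply: le_trans B16; rewrite ler_nat.
rewrite -!exprD ler_weXn2l //; clear -n0 k0; nia.
Qed.

Lemma min_size_gt0 : 0 < min_size.
Proof. by apply: lt_le_trans min_size_ge; rewrite exprn_gt0. Qed.

(** With [32 * n <= B ^+ 3] this reduces to [147 * n * k + 25 <= 172 * n * k], an equality when
    [n * k = 1]; the exponent 49 comes from this count. *)
Lemma param_regularity :
  (B ^+ (49 * n * k)) ^+ 3 <= (32 * n%:R)^-1 ^+ 6 * B^-1 ^+ 7 * min_size ^+ 2.
Proof.
have n32 : 32 * n%:R <= B ^+ 3.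
  rewrite exprSr; apply: ler_pM => //.
  by apply: le_trans B2_256; rewrite ler_nat.
have n32_0 : 0 < 32 * n%:R :> R by rewrite mulr_gt0 // ltr0n.
rewrite !exprVn -mulrA mulrC ler_pdivlMr ?exprn_gt0 //.
rewrite mulrC [X in _ <= X]mulrC ler_pdivlMr ?exprn_gt0 //.
apply: (@le_trans _ _ ((B ^+ (86 * n * k)) ^+ 2)); last first.
  rewrite lerXn2r ?nnegrE ?(ltW min_size_gt0) ?exprn_ge0 ?(ltW B0) //.
  exact: min_size_ge.
apply: (@le_trans _ _ ((B ^+ 3) ^+ 6 * (B ^+ (49 * n * k)) ^+ 3 * B ^+ 7)).
  rewrite ler_wpM2r ?exprn_ge0 ?(ltW B0) //.
  rewrite ler_wpM2r ?exprn_ge0 ?(ltW B0) //.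
  by rewrite lerXn2r ?nnegrE ?(ltW n32_0) ?exprn_ge0 ?(ltW B0).
rewrite -!exprM -!exprD ler_weXn2l //; clear -n0 k0; nia.
Qed.

(** Equivalent to [256 * n ^ 3 <= B ^ 3]. The right side is the threshold for [n] remaining
    vertices; the 2 on the left counts red pairs and coinciding vertices. *)
Lemma param_potential :
  n%:R ^+ 2 * (2 * (B ^+ 4)^-1) <= (32 * n%:R)^-1 * B^-1 / 4.
Proof.
have n32_0 : 0 < 32 * n%:R :> R by rewrite mulr_gt0 // ltr0n.
rewrite -!invfM mulrA ler_pdivrMr ?exprn_gt0 // [leRHS]mulrC ler_pdivlMr; last first.
  by rewrite !mulr_gt0 ?ltr0n.
rewrite [leLHS](_ : _ = (256 * n%:R ^+ 3) * B); last by ring.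
rewrite [leRHS]exprSr ler_wpM2r ?(ltW B0) // [leRHS]exprSr.
by apply: ler_pM; rewrite ?exprn_ge0 ?ler0n.
Qed.

(** Ensures that coinciding vertices have density at most [B ^- 4] between two parts. *)
Lemma param_diagonal :
  B ^+ 4 <= (B ^+ 5)^-1 ^+ (n.+1 * k) * (B ^+ (49 * n * k)) ^+ 2.
Proof.
have h : min_size <= (B ^+ 5)^-1 ^+ (n.+1 * k) * (B ^+ (49 * n * k)) ^+ 2.
  rewrite /min_size ler_piMr ?mulr_ge0 ?exprn_ge0 ?invr_ge0 ?exprn_ge0 ?(ltW B0) //.
  rewrite exprn_ile1 ?mulr_ge0 ?invr_ge0 ?(ltW B0) //.
  by rewrite -invfM invf_le1 ?mulr_gt0 //; have := B1; lra.
apply: le_trans h; apply: le_trans min_size_ge.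
rewrite ler_weXn2l //; clear -n0 k0; nia.
Qed.

End Constants.

(** * The Ramsey argument *)

Section CliqueArrows.

Variables (F : finFieldType) (n k mu : nat).

Let M := 2 ^ mu.
Let K := 2 ^ k * (49 * n * k).
Let V : finType := (F * F)%type.

Hypotheses (n1 : 1 < n) (k0 : 0 < k) (nM : n ^ 2 <= M) (cF : #|F| = M ^ K).

(* The labels are numbers with K digits in base M; a word w selects the labels whose
   most significant digits spell w. *)
Definition field_label (x y : V) : nat := enum_rank (fadj x y).

Lemma field_labelC x y : field_label x y = field_label y x.
Proof. by rewrite /field_label fadjC. Qed.

(** Improper or overlong words have an empty class, so that passing to a prefix needs no side
    condition despite the truncated subtraction. *)
Definition color_class (c : {set V} -> bool) (w : seq nat) (x y : V) : bool :=
  [&& all (gtn M) w, size w <= K, x != y, c [set x; y] &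
      field_label x y %/ M ^ (K - size w) == word_value M w].

Lemma color_classC c w x y : color_class c w x y = color_class c w y x.
Proof. by rewrite /color_class eq_sym setUC field_labelC. Qed.

Lemma color_class_prefix c w v x y :
  color_class c (w ++ v) x y -> color_class c w x y.
Proof.
rewrite /color_class all_cat size_cat => /and5P[/andP[wM vM] sz xy cxy /eqP E].
rewrite wM xy cxy (leq_trans (leq_addr _ _) sz) /=; apply/eqP.
rewrite -(word_value_cat w vM) -E -divnMA -expnD; congr (_ %/ _ ^ _).
by lia.
Qed.

Let M_gt0 : 0 < M. Proof. by rewrite expn_gt0. Qed.

Let mu_gt1 : 1 < mu.
Proof.
have : 2 ^ 2 <= 2 ^ mu by apply: leq_trans nM; rewrite leq_exp2r.
by rewrite leq_exp2l.
Qed.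

Let k_lt : k.+1 <= 2 ^ k. Proof. exact: ltn_expl. Qed.

(** A word of [2 ^ k] digits selects a share [B^-1] of the labels: [2 ^ k - 1] digits come from the
    sparse parts and one encodes an edge rank. *)
Let B : rat := (M ^ (2 ^ k))%:R%R.

Local Open Scope ring_scope.

Let B_ge16 : 16 <= B.
Proof.
rewrite /B /M -expnM (ler_nat _ (2 ^ 4)) leq_exp2l //.
have := mu_gt1; have := k_lt; have := k0; nia.
Qed.

Let B_ge_n4 : n%:R ^+ 4 <= B.
Proof.
rewrite -natrX ler_nat -[4%N]/(2 * 2)%N expnM.
apply: leq_trans (_ : M ^ 2 <= _)%N; first by rewrite leq_exp2r.
rewrite leq_pexp2l ?M_gt0 //.
have := k_lt; have := k0; lia.
Qed.

Let B_ge_parts : 2 ^+ k.+1 <= B.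
Proof.
rewrite -natrX ler_nat /M -expnM leq_exp2l //.
have := mu_gt1; have := k_lt; nia.
Qed.

Let card_F : #|F|%:R = B ^+ (49 * n * k) :> rat.
Proof. by rewrite cF /K expnM natrX. Qed.

Lemma word_class_pseudorandom (w : seq nat) (a : nat) :
  all (gtn M) w -> (a < M)%N -> (size w).+1 = (2 ^ k)%N ->
  pseudorandom B^-1 ((B ^+ (49 * n * k)) ^+ 3)
    (fun x y : V => field_label x y %/ M ^ (K - (size w).+1) == word_value M w * M + a)%N.
Proof.
move=> wM aM sz; set e := (K - (size w).+1)%N.
have sK : ((size w).+1 <= K)%N.
  by rewrite sz /K leq_pmulr // !muln_gt0 k0 (ltnW n1).
pose S := [set z : F | enum_rank z %/ M ^ e == word_value M w * M + a]%N.
have cS : #|S| = (M ^ e)%N.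
  apply: card_label_class; first by rewrite expn_gt0 M_gt0.
  have wa : all (gtn M) (rcons w a) by rewrite all_rcons wM /= aM.
  have := word_value_lt wa; rewrite word_value_rcons size_rcons => lt.
  rewrite cF -(subnK sK) -/e expnD mulnC; exact: leq_mul.
have := fadj_pseudorandom (R := rat) S; rewrite cS card_F.
have -> : (M ^ e)%:R / B ^+ (49 * n * k) = B^-1.
  rewrite -card_F cF -(subnK sK) -/e expnD natrM sz -/B invfM mulrA divff ?mul1r //.
  by rewrite pnatr_eq0 -lt0n expn_gt0 M_gt0.
congr pseudorandom; apply/funext => x; apply/funext => y.
by rewrite inE.
Qed.

Lemma ecount_diagonal (A C : {set V}) : ecount rat (fun x y => x == y) A C <= #|A|%:R.
Proof.
rewrite /ecount -sumr_const; apply: ler_sum => x _.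
case xC: (x \in C).
  rewrite (big_setD1 x) //= eqxx big1 ?addr0 // => y /setD1P[yx _].
  by rewrite eq_sym (negbTE yx).
rewrite big1 // => y yC; case: eqP => // xy; by rewrite xy yC in xC.
Qed.

Lemma ecountC (r : rel V) (A C : {set V}) : symmetric r ->
  ecount rat r A C = ecount rat r C A.
Proof.
move=> rC; rewrite /ecount exchange_big /=; apply: eq_bigr => x _.
by apply: eq_bigr => y _; rewrite rC.
Qed.

Lemma ecount_or (r r1 r2 : rel V) (A C : {set V}) :
  (forall x y, r x y -> r1 x y || r2 x y) ->
  ecount rat r A C <= ecount rat r1 A C + ecount rat r2 A C.
Proof.
move=> h; rewrite /ecount -big_split /=; apply: ler_sum => x _.
rewrite -big_split /=; apply: ler_sum => y _.
by have := h x y; case: (r x y) => [/(_ isT)|_]; case: (r1 x y); case: (r2 x y).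
Qed.

Lemma clique_edge_arrows (G : eograph V) (T1 T2 : finType) (H1 : eograph T1)
    (H2 : eograph T2) :
  verts G = setT -> edges G = [set e : {set V} | #|e| == 2%N] ->
  (forall d e, ele G d e = (edge_key field_label d <= edge_key field_label e)%N) ->
  #|verts H1| = n -> #|verts H2| = n -> colorable H2 (2 ^ k) ->
  edge_arrows G H1 H2.
Proof.
move=> vG eG lG cH1 cH2 [chi [chik chiH]] c.
have [s1 _] : exists s, s \in verts H1 by apply/card_gt0P; rewrite cH1 ltnW.
have [s2 _] : exists s, s \in verts H2 by apply/card_gt0P; rewrite cH2 ltnW.
pose a i j := label_at H1 s1 i j.
have aM i j : (a i j < M)%N by apply: label_at_lt; rewrite ?M_gt0 ?cH1.
have [[w [x [wM hx]]]|nored] := pselect (exists w (x : nat -> V), all (gtn M) w /\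
    forall i j, (i < j)%N -> (j < n)%N -> color_class c (rcons w (a i j)) (x i) (x j)).
  left; apply: (copy_of_pattern (s0 := s1) (x := x) (B := (M ^ (K - (size w).+1))%N)
    (p := (word_value M w * M)%N) field_labelC vG eG lG).
    by move=> i j ij; rewrite cH1 => jn; have /and5P[] := hx i j ij jn.
  move=> i j ij; rewrite cH1 => jn _; have /and5P[_ _ _ cx /eqP] := hx i j ij jn.
  by rewrite size_rcons word_value_rcons.
right.
have [B16 Bn Bk] := And3 B_ge16 B_ge_n4 B_ge_parts.
have n0 : (0 < n)%N by exact: ltnW.
have B0 : 0 < B by apply: lt_le_trans B16.
have B1 : 1 <= B by apply: le_trans B16.
pose del : rat := (B ^+ 5)^-1; pose del' : rat := (B ^+ 4)^-1.
have del0 : 0 < del by rewrite invr_gt0 exprn_gt0.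
have del'0 : 0 < del' by rewrite invr_gt0 exprn_gt0.
have del'1 : del' <= 1 by rewrite invf_le1 ?exprn_gt0 // exprn_ege1.
have none w : all (gtn M) w -> ~ exists x : nat -> V,
     forall i j, (i < j)%N -> (j < n)%N -> color_class c (rcons w (a i j)) (x i) (x j).
  by move=> wM [x hx]; apply: nored; exists w, x.
have V0 : (0 < #|[set: V]|)%N by apply/card_gt0P; exists (0, 0); rewrite inE.
have [v [U [szv vM _ cU dU]]] := sparse_parts (0, 0) del0 (param_degree n0 B16 Bn) del'0
  del'1 n0 (@color_class_prefix c) aM none (param_density B16 Bk) V0 (isT : all (gtn M) [::]).
have cV : #|[set: V]|%:R = (B ^+ (49 * n * k)) ^+ 2 :> rat.
  by rewrite cardsT card_prod natrM card_F expr2.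
rewrite cV in cU.
have szv1 : (size v).+1 = (2 ^ k)%N by rewrite szv prednK ?expn_gt0.
pose col i := chi (vertex_at H2 s2 i).
have inH2 i : (i < n)%N -> vertex_at H2 s2 i \in verts H2.
  by move=> im; rewrite -mem_enum mem_nth // -cardE cH2.
have colk i : (i < n)%N -> (col i < 2 ^ k)%N by move=> im; apply/chik/inH2.
pose l i j := if (i < j)%N then label_at H2 s2 i j else 0%N.
have lM i j : (l i j < M)%N.
  by rewrite /l; case: ifP => _; rewrite ?M_gt0 // label_at_lt ?M_gt0 ?cH2.
pose nb i j (x y : V) :=
  (field_label x y %/ M ^ (K - (size v).+1) == word_value M v * M + l i j)%N.
(* Forbidding equal vertices makes the embedding injective. Red pairs are forbidden only along edges
   of [H2], since nothing is known about red pairs inside one part. *)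
pose r i j (x y : V) :=
  (x == y) || (edge_at H2 s2 i j \in edges H2) && color_class c v x y.
pose eps : rat := (32 * n%:R)^-1.
have nR : 0 < n%:R :> rat by rewrite ltr0n.
have epsE : eps * (32 * n%:R) = 1 by rewrite mulVf // mulf_neq0 ?gt_eqF.
have lam0 : 0 < B^-1 by rewrite invr_gt0.
have lam1 : B^-1 <= 1 by rewrite invf_le1.
have beta0 : 0 <= (B ^+ (49 * n * k)) ^+ 3 by rewrite !exprn_ge0 ?(ltW B0).
have nbC i j : symmetric (nb i j) by move=> x y; rewrite /nb field_labelC.
have nbP i j : pseudorandom B^-1 ((B ^+ (49 * n * k)) ^+ 3) (nb i j).
  exact: word_class_pseudorandom.
have hsize i : (i < n)%N ->
    (2 / B^-1) ^+ n * min_size B n k <= #|U (col i)|%:R.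
  move=> im; apply: le_trans (cU _ (colk i im)).
  rewrite [leLHS]mulrC /min_size -[leLHS]mulrA -exprMn.
  have -> : B^-1 / 2 * (2 / B^-1) = 1 by field; rewrite gt_eqF.
  by rewrite expr1n mulr1.
have szU i : (i < n)%N -> B ^+ 4 <= #|U (col i)|%:R.
  move=> im; apply: le_trans (cU _ (colk i im)).
  exact: param_diagonal.
have hpot : potential rat n (fun i => U (col i)) r <= threshold n eps B^-1 n.
  apply: le_trans (sum_triangle_le (G := fun i j => ecount rat (r i j) (U (col i)) (U (col j))
      / (#|U (col i)|%:R * #|U (col j)|%:R)) (e := 2 * del') (leqnn n) _ _) _.
  - by rewrite mulr_ge0 ?(ltW del'0).
  - move=> i j ij jn; have im := ltn_trans ij jn.
    have Ui : 0 < #|U (col i)|%:R :> rat.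
      by apply: lt_le_trans (szU i im); rewrite exprn_gt0.
    have Uj : 0 < #|U (col j)|%:R :> rat.
      by apply: lt_le_trans (szU j jn); rewrite exprn_gt0.
    rewrite ler_pdivrMr ?mulr_gt0 // mulrDl mulrDl.
    pose r2 (x y : V) := (edge_at H2 s2 i j \in edges H2) && color_class c v x y.
    have hor x y : r i j x y -> (x == y) || r2 x y by [].
    apply: le_trans (ecount_or _ _ hor) _.
    rewrite lerD //.
      apply: le_trans (ecount_diagonal _ _) _; rewrite mul1r mulrCA ler_peMr ?(ltW Ui) //.
      by rewrite mulrC ler_pdivlMr ?exprn_gt0 // mul1r szU.
    rewrite mul1r /r2; case ijH: (_ \in _) => /=; last first.
      rewrite /ecount big1 ?mulr_ge0 ?(ltW del'0) ?(ltW Ui) ?(ltW Uj) // => x _.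
      by rewrite big1.
    (* [dU] covers increasing part indices; symmetry gives the decreasing case, and an edge of [H2]
       joins different colours. *)
    have [lt|lt|E] := ltngtP (col i) (col j).
    + exact: dU lt (colk j jn).
    + rewrite ecountC; last by move=> x y; exact: color_classC.
      by rewrite [X in _ * X]mulrC; exact: dU lt (colk i im).
    by case: (chiH _ _ ijH).
  apply: le_trans (param_potential n0 B16 Bn) _.
  rewrite /threshold natrD le_eqVlt; apply/orP; left; apply/eqP.
  have nn : n%:R + n%:R != 0 :> rat by rewrite gt_eqF ?addr_gt0.
  by rewrite -/eps; field; rewrite nn (gt_eqF B0).
have [x [_ hx]] := regular_embedding n0 epsE lam0 lam1 beta0
  (min_size_gt0 n0 k0 B16) (param_regularity n0 k0 B16 Bn) (0, 0) (leqnn n) nbC nbP hsize hpot.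
apply: (copy_of_pattern (s0 := s2) (x := x) (B := (M ^ (K - (size v).+1))%N)
    (p := (word_value M v * M)%N) field_labelC vG eG lG).
  move=> i j ij; rewrite cH2 => jn; have [_] := hx i j ij jn.
  by rewrite negb_or => /andP[].
move=> i j ij; rewrite cH2 => jn ijH; have [/eqP nbij] := hx i j ij jn.
rewrite /r negb_or ijH /= => /andP[xij nred]; split; first by rewrite nbij /l ij.
(* If the pair were red, deleting the last digit of its label prefix would leave [v], putting the
   pair in the forbidden class. *)
apply: contraNF nred => cx.
have sK : (size v < K)%N.
  by rewrite szv1 /K leq_pmulr // !muln_gt0 k0 n0.
rewrite /color_class vM (ltnW sK) xij cx /=; apply/eqP.
by rewrite -(subnSK sK) expnSr divnMA nbij divnMDl ?M_gt0 // divn_small ?addn0.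
Qed.

End CliqueArrows.

(** * Choice of parameters and the final bound *)

(** Rounding up adds at most 1, and [1 <= log2 m] because [m >= 2]. *)
Lemma up_log_le_log2 (R : realType) (m : nat) : 1 < m ->
  ((up_log 2 m)%:R <= 2 * log2 (m%:R : R))%R.
Proof.
move=> m1; have ln2 : (0 < ln (2 : R))%R by apply: ln_gt0; rewrite ltr1n.
have m0 : (0 < m%:R :> R)%R by rewrite ltr0n ltnW.
have log_ge (e : nat) : 2 ^ e <= m -> (e%:R <= log2 (m%:R : R))%R.
  move=> em; rewrite /log2 ler_pdivlMr // mulr_natl -lnXn ?ltr0n //.
  by rewrite ler_ln ?posrE ?exprn_gt0 // -natrX ler_nat.
have /andP[lt _] := up_log_bounds (isT : 1 < 2) m1.
have := log_ge _ (ltnW lt); have := log_ge 1 m1.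
have e0 : 0 < up_log 2 m by rewrite up_log_gt0.
have -> : ((up_log 2 m)%:R = (up_log 2 m).-1%:R + 1 :> R)%R by rewrite natr1 prednK.
lra.
Qed.

Lemma up_log_pow_le m : 1 < m -> 2 ^ up_log 2 m <= 2 * m.
Proof.
move=> m1; have /andP[lt _] := up_log_bounds (isT : 1 < 2) m1.
have e0 : 0 < up_log 2 m by rewrite up_log_gt0.
by rewrite -(prednK e0) expnS leq_mul2l ltnW.
Qed.

(** The constant is [49 * 2 * 2 * 8]: one 2 for the two coordinates of a vertex, one for [mu], and 8
    for rounding [t'] and the two logarithms. *)
Lemma exists_arrowing_clique (R : realType) (n t : nat) : 0 < n -> 1 < t ->
  exists (V : finType) (G : eograph V),
    (#|verts G|%:R <= bound (1568 : R) n t)%R /\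
    forall (T1 T2 : finType) (H1 : eograph T1) (H2 : eograph T2),
      Fam n H1 -> Famchi n t H2 -> edge_arrows G H1 H2.
Proof.
(* For [n = 1] the bound is 1 because [log2 1 = 0], so a single vertex must do; it has no pairs to
   check. *)
case: n => // -[_|n _] t1.
  have labC : forall x y : unit, 0 = 0 by [].
  have [G [vG eG lG]] := exists_labelled_clique (fun _ _ : unit => 0).
  exists unit, G; split.
    by rewrite vG cardsT card_unit /bound /log2 ln1 mul0r mulr0 mul0r powRr0.
  move=> T1 T2 H1 H2 cH1 _ c; left.
  have [s _] : exists s, s \in verts H1 by apply/card_gt0P; rewrite cH1.
  by apply: (copy_of_pattern (s0 := s) (x := fun=> tt) (B := 0) (p := 0) labC vG eG lG);
    move=> i j; rewrite cH1; case: j.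
set n' := n.+2; have n1 : 1 < n' by [].
pose t' := minn t n'; have t'1 : 1 < t' by rewrite leq_min t1.
have tt' : t' <= t by exact: geq_minl.
(* Taking [M = 2 ^ mu] makes [M ^ K] a prime power, and the factor 2 in [mu] gives [n' ^ 2 <= M], so
   one digit holds any edge rank. *)
pose k := up_log 2 t'; pose mu := 2 * up_log 2 n'.
have k0 : 0 < k by rewrite up_log_gt0.
have nM : n' ^ 2 <= 2 ^ mu.
  by rewrite /mu mulnC expnM leq_exp2r // up_logP.
have mu0 : 0 < mu by rewrite muln_gt0 up_log_gt0.
have e0 : 0 < mu * (2 ^ k * (49 * n' * k)).
  by rewrite muln_gt0 mu0 !muln_gt0 expn_gt0 k0.
have [F _ cF] := pPrimePowerField (isT : prime 2) e0.
rewrite expnM in cF.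
have [G [vG eG lG]] := exists_labelled_clique (@field_label F).
exists (F * F)%type, G; split; last first.
  move=> T1 T2 H1 H2 cH1 [cH2 chi].
  apply: (clique_edge_arrows n1 k0 nM cF vG eG lG cH1 cH2).
  apply: (@colorable_mono _ _ t'); last exact: up_logP.
  rewrite /t'; case: leqP => _; first exact: chromatic_numberP.
  by rewrite -cH2; exact: colorable_card.
rewrite vG cardsT card_prod cF -!expnM -expnD natrX -powR_mulrn ?ler0n //.
rewrite /bound ler_powR ?ler1n //.
have := up_log_le_log2 R n1; have := up_log_le_log2 R t'1.
rewrite -/k; set lt' := log2 _; set ln' := log2 _; set a := (up_log 2 n')%:R%R => hk hn.
have lt_le : (lt' <= log2 (t%:R : R))%R.
  rewrite /lt' /log2 ler_wpM2r ?invr_ge0 ?ln_ge0 ?ler1n //.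
  by rewrite ler_ln ?ler_nat // posrE ltr0n ltnW.
have h2k : ((2 ^ k)%:R <= 2 * t%:R :> R)%R.
  rewrite -natrM ler_nat; apply: leq_trans (up_log_pow_le t'1) _.
  by rewrite leq_mul2l.
have -> : ((mu * (2 ^ k * (49 * n' * k)) + mu * (2 ^ k * (49 * n' * k)))%:R
    = 196 * n'%:R * ((2 ^ k)%:R * (a * k%:R)) :> R)%R.
  by rewrite /mu /a !natrD !natrM; ring.
have -> : (1568 * n'%:R * t%:R * ln' * log2 t%:R
    = 196 * n'%:R * ((2 * t%:R) * ((2 * ln') * (2 * log2 t%:R))) :> R)%R.
  by ring.
rewrite ler_wpM2l ?mulr_ge0 ?ler0n //.
apply: ler_pM => //; first by rewrite mulr_ge0 ?ler0n.
apply: ler_pM; rewrite ?ler0n //.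
by apply: le_trans hk _; rewrite ler_wpM2l.
Qed.

Theorem theorem8 (R : realType) :
  exists C : R, (0 < C)%R /\
    forall n t : nat, 0 < n -> 2 <= t ->
      (exists (T : finType) (G : eograph T),
         (#|verts G|%:R <= bound C n t)%R /\
         ramsey_universal (Famchi n t) G) /\
      (forall (T1 T2 : finType) (H1 : eograph T1) (H2 : eograph T2),
         Fam n H1 -> Famchi n t H2 ->
         exists N : nat, is_r_edge H1 H2 N /\ (N%:R <= bound C n t)%R).
Proof.
exists 1568%:R%R; split; first by rewrite ltr0n.
move=> n t n0 t2; have [V [G [cG arr]]] := exists_arrowing_clique R n0 t2; split.
  by exists V, G; split=> //; exact: arrows_universal.
move=> T1 T2 H1 H2 F1 F2.
have [N hN NG] := edge_arrows_is_r_edge (arr T1 T2 H1 H2 F1 F2).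
by exists N; split=> //; apply: le_trans cG; rewrite ler_nat.
Qed.
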